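(* Let $-3<\alpha\le 1$ and let $f\in\mathcal{SK}(\alpha)$. Let the logarithmic coefficients $\gamma_n$ of $f$ be defined by $\log\frac{f(z)}{z}=\sum_{n=1}^\infty 2\gamma_n z^n$ ($z\in\Delta$, branch vanishing at $0$). Then \[ \sum_{n=1}^\infty|\gamma_n|^2\le\frac{1}{4(3+\alpha)^2}\left[\frac{3\pi^2}{2}+6\alpha\,\mathrm{Li}_2\!\left(-\frac{\alpha}{3}\right)+\alpha^2\,\mathrm{Li}_2\!\left(\frac{\alpha^2}{9}\right)\right], \] where $\mathrm{Li}_2(z)=\sum_{n=1}^\infty z^n/n^2$. The inequality is sharp, i.e. equality holds for some function in $\mathcal{SK}(\alpha)$.
   Context: $\Delta=\{z:|z|<1\}$. For analytic $F,G$ on $\Delta$, $F\prec G$ means there is an analytic $w:\Delta\to\Delta$ with $w(0)=0$ and $F=G\circ w$ on $\Delta$. For $\alpha\in(-3,1]$, $\widetilde{q}_\alpha(z)=\dfrac{3}{3+(\alpha-3)z-\alpha z^2}$. The class $\mathcal{SK}(\alpha)$ consists of all analytic $f$ on $\Delta$ with $f(0)=0$, $f'(0)=1$ and $\dfrac{zf'(z)}{f(z)}\prec\widetilde{q}_\alpha(z)$ in $\Delta$. *)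

(* Defs.v *)
From Stdlib Require Import Reals.
From Coquelicot Require Export Coquelicot.
Open Scope R_scope.

Definition in_disc (z : C) : Prop := Cmod z < 1.

Definition C_is_derive (f : C -> C) (z l : C) : Prop :=
  @is_derive C_AbsRing C_NormedModule f z l.

Definition analytic_on_disc (f : C -> C) : Prop :=
  forall z, in_disc z -> @ex_derive C_AbsRing C_NormedModule f z.

Definition subordinate (F G : C -> C) : Prop :=
  exists w : C -> C, analytic_on_disc w /\ w 0%C = 0%C /\
    (forall z, in_disc z -> in_disc (w z)) /\
    (forall z, in_disc z -> F z = G (w z)).

Definition qt (alpha : R) (z : C) : C :=
  Cdiv (RtoC 3)
    (Cplus (Cplus (RtoC 3) (Cmult (RtoC (alpha - 3)) z))
           (Copp (Cmult (RtoC alpha) (Cmult z z)))).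

(* The function z f'(z)/f(z), extended at z = 0 by its limit f'(0) (= 1 for
   normalized f), which is the analytic function referred to in the definition. *)
Definition zfp_over_f (f f' : C -> C) (z : C) : C :=
  if Ceq_dec z 0%C then f' 0%C else Cdiv (Cmult z (f' z)) (f z).

(* The class SK(alpha): f analytic on Delta with derivative f', f(0)=0, f'(0)=1,
   z f'/f analytic on Delta (i.e. f has no zero in Delta \ {0}) and
   z f'/f ≺ q~_alpha. *)
Definition SK (alpha : R) (f : C -> C) : Prop :=
  exists f' : C -> C,
    (forall z, in_disc z -> C_is_derive f z (f' z)) /\
    f 0%C = 0%C /\ f' 0%C = 1%C /\
    (forall z, in_disc z -> z <> 0%C -> f z <> 0%C) /\
    subordinate (zfp_over_f f f') (qt alpha).

Definition Cexp (z : C) : C := (exp (fst z) * cos (snd z), exp (fst z) * sin (snd z)).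

(* gamma : nat -> C (gamma 0 is unused) is the sequence of logarithmic
   coefficients of f:  log (f z / z) = sum_{n>=1} 2 gamma_n z^n on Delta, with
   the branch vanishing at 0 (the series has no constant term). *)
Definition log_coeffs (f : C -> C) (gamma : nat -> C) : Prop :=
  forall z, in_disc z ->
    exists L : C,
      @is_pseries C_AbsRing C_NormedModule
        (fun n => if Nat.eqb n 0 then (0%C : C) else (Cmult (RtoC 2) (gamma n) : C)) z L /\
      (z <> 0%C -> Cexp L = Cdiv (f z) z).

Definition Li2 (x : R) : R := Series (fun n => x ^ (S n) / (INR (S n)) ^ 2).

Definition sk_bound (alpha : R) : R :=
  / (4 * (3 + alpha) ^ 2) *
  (3 * PI ^ 2 / 2 + 6 * alpha * Li2 (- alpha / 3) + alpha ^ 2 * Li2 (alpha ^ 2 / 9)).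

Definition sq_terms (gamma : nat -> C) : nat -> R := fun n => (Cmod (gamma (S n))) ^ 2.

(* Main.v *)
(* Put [L(z) = log (f(z)/z) = sum 2 gamma_n z^n].  Then [z f'/f = 1 + z L'] has coefficients
   [2 n gamma_n], and it equals [q o w], where [q] is the rational function
   [3 / ((1 - z)(3 + alpha z))] with coefficients
   [B_n = 3/(3 + alpha) (1 + (alpha/3) (-alpha/3)^n)].  Rogosinski's inequality
   [sum_(k<=n) |2 k gamma_k|^2 <= sum_(k<=n) B_k^2] and Abel summation against [1/k^2] give
   [4 sum |gamma_k|^2 <= sum B_k^2/k^2], which is the stated dilogarithm expression because
   [sum 1/k^2 = PI^2/6].  Equality holds for [w(z) = z], i.e. [gamma_n = B_n/(2n)].

   Rogosinski's inequality only needs mean values of C^1 holomorphic functions on circles.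
   That [w] is C^1 follows from the equation [q(w) = 1 + z L'], as [q' <> 0] on the disc. *)
Require Import Defs.
From Stdlib Require Import Reals Lra Lia.
From Coquelicot Require Import Coquelicot.
Open Scope R_scope.

(** * Complex differentiability *)

(** The numbers [B_k] tend to the positive limit [3 / (3 + alpha)], so [sum B_k^2] diverges and only
    a comparison of partial sums carries information. Rogosinski's inequality does not give
    [|2 k gamma_k| <= B_k] term by term either; the weights [1/k^2] can be inserted only because
    they decrease, and this is the role of Abel summation.

    The function [w] is known only to be complex differentiable, so it is never expanded in a power
    series. Both series are cut at degree [n] instead: [pol n b (w z)] and [pol n a z] differ by
    [O(z^(n+1))], and such an error is orthogonal on every circle to polynomials of degree [n].
    Orthogonality means that a circle mean is zero. It is obtained by differentiating the mean with
    respect to the radius under the integral sign, which asks for a continuous derivative; hence the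
    detour through the C^1 property of [w]. *)

(** The codomain is the ring [C_AbsRing] seen as a module over itself, the structure for which the
    product and composition rules are stated; [C_is_derive_iff] translates to the notion in the
    definition of the class. *)
Definition cderiv (f : C -> C) (z l : C) : Prop :=
  @is_derive C_AbsRing (AbsRing_NormedModule C_AbsRing) f z l.

Definition ccont (f : C -> C) (z : C) : Prop :=
  @continuous (AbsRing_UniformSpace C_AbsRing) (AbsRing_UniformSpace C_AbsRing) f z.

Lemma ccont_iff (f : C -> C) (z : C) :
  ccont f z <-> forall eps : posreal, exists d : posreal,
    forall y, Cmod (y - z)%C < d -> Cmod (f y - f z)%C < eps.
Proof.
  split.
  - intros H eps.
    destruct (H (fun y => Cmod (y - f z)%C < eps)) as [d Hd].
    + exists eps. intros y Hy. exact Hy.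
    + exists d. intros y Hy. apply (Hd y). exact Hy.
  - intros H P [eps HP].
    destruct (H eps) as [d Hd].
    exists d. intros y Hy. apply HP. apply (Hd y Hy).
Qed.

Lemma cderiv_iff (f : C -> C) (z l : C) :
  cderiv f z l <-> forall eps : posreal, exists d : posreal,
    forall y, Cmod (y - z)%C < d ->
      Cmod (f y - f z - (y - z) * l)%C <= eps * Cmod (y - z)%C.
Proof.
  split.
  - intros [_ H] eps.
    destruct (H z (fun P HP => HP) eps) as [d Hd].
    exists d. intros y Hy. apply (Hd y). exact Hy.
  - intros H. split.
    + apply is_linear_scal_l.
    + intros x Hx.
      assert (E : z = x).
      { apply (@is_filter_lim_locally_unique C_AbsRing (AbsRing_NormedModule C_AbsRing)).
        exact Hx. }
      rewrite <- E. intros eps.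
      destruct (H eps) as [d Hd]. exists d. intros y Hy. apply (Hd y). exact Hy.
Qed.

(** Both module structures on the codomain have the norm [Cmod], so the little-o conditions agree by
    conversion; only the linearity component is rebuilt. *)
Lemma C_is_derive_iff (f : C -> C) (z l : C) : C_is_derive f z l <-> cderiv f z l.
Proof.
  split.
  - intros [[H1 H2 H3] H]. split.
    + apply is_linear_scal_l.
    + intros x Hx eps. apply (H x Hx eps).
  - intros [_ H]. split.
    + apply (@is_linear_scal_l C_AbsRing C_NormedModule).
    + intros x Hx eps. apply (H x Hx eps).
Qed.

Lemma cderiv_cont (f : C -> C) (z l : C) : cderiv f z l -> ccont f z.
Proof.
  intros H. apply (@ex_derive_continuous C_AbsRing (AbsRing_NormedModule C_AbsRing) f z).
  exists l. exact H.
Qed.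

Lemma cderiv_unique (f : C -> C) (z l1 l2 : C) :
  cderiv f z l1 -> cderiv f z l2 -> l1 = l2.
Proof.
  intros H1 H2. apply C_is_derive_iff in H1, H2.
  rewrite <- (is_C_derive_unique f z l1 H1). apply (is_C_derive_unique f z l2 H2).
Qed.

Lemma cderiv_ext_loc (f g : C -> C) (z l : C) (d : posreal) :
  (forall y, Cmod (y - z)%C < d -> f y = g y) -> cderiv f z l -> cderiv g z l.
Proof.
  intros E H. apply (@is_derive_ext_loc C_AbsRing (AbsRing_NormedModule C_AbsRing) f); auto.
  exists d. intros y Hy. apply E. exact Hy.
Qed.

Lemma cderiv_eq (f : C -> C) (z l l' : C) : cderiv f z l -> l = l' -> cderiv f z l'.
Proof. now intros H <-. Qed.

Lemma cderiv_const (c z : C) : cderiv (fun _ => c) z 0%C.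
Proof. apply (@is_derive_const C_AbsRing (AbsRing_NormedModule C_AbsRing)). Qed.

Lemma cderiv_id (z : C) : cderiv (fun x => x) z 1%C.
Proof. apply (@is_derive_id C_AbsRing). Qed.

Lemma cderiv_plus (f g : C -> C) (z a b : C) :
  cderiv f z a -> cderiv g z b -> cderiv (fun x => f x + g x)%C z (a + b)%C.
Proof. apply (@is_derive_plus C_AbsRing (AbsRing_NormedModule C_AbsRing)). Qed.

Lemma cderiv_mult (f g : C -> C) (z a b : C) :
  cderiv f z a -> cderiv g z b -> cderiv (fun x => f x * g x)%C z (a * g z + f z * b)%C.
Proof.
  intros Hf Hg. apply (@is_derive_mult C_AbsRing); auto.
  intros n m. apply Cmult_comm.
Qed.

Lemma cderiv_comp (f g : C -> C) (z a b : C) :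
  cderiv f (g z) a -> cderiv g z b -> cderiv (fun x => f (g x)) z (b * a)%C.
Proof. apply (@is_derive_comp C_AbsRing (AbsRing_NormedModule C_AbsRing)). Qed.

Lemma ccont_const (c z : C) : ccont (fun _ => c) z.
Proof. eapply cderiv_cont, cderiv_const. Qed.

Lemma ccont_id (z : C) : ccont (fun x => x) z.
Proof. eapply cderiv_cont, cderiv_id. Qed.

Lemma ccont_plus (f g : C -> C) (z : C) :
  ccont f z -> ccont g z -> ccont (fun x => f x + g x)%C z.
Proof.
  apply (@continuous_plus (AbsRing_UniformSpace C_AbsRing) C_AbsRing
           (AbsRing_NormedModule C_AbsRing)).
Qed.

Lemma ccont_mult (f g : C -> C) (z : C) :
  ccont f z -> ccont g z -> ccont (fun x => f x * g x)%C z.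
Proof. apply (@continuous_mult (AbsRing_UniformSpace C_AbsRing) C_AbsRing). Qed.

Lemma ccont_comp (f g : C -> C) (z : C) :
  ccont g z -> ccont f (g z) -> ccont (fun x => f (g x)) z.
Proof. intros H1 H2.
  now apply (@continuous_comp (AbsRing_UniformSpace C_AbsRing) (AbsRing_UniformSpace C_AbsRing)
           (AbsRing_UniformSpace C_AbsRing) g f).
Qed.

Lemma Cmod_triangle_inv (x y : C) : Cmod x - Cmod y <= Cmod (x - y)%C.
Proof.
  assert (H := Cmod_triangle (x - y) y).
  replace (x - y + y)%C with x in H by ring. lra.
Qed.

Lemma cderiv_Cinv (z : C) : z <> 0%C -> cderiv Cinv z (- / (z * z))%C.
Proof.
  intros Hz. apply cderiv_iff. intros eps.
  assert (Hm : 0 < Cmod z) by now apply Cmod_gt_0.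
  set (m := Cmod z) in *.
  (* The remainder of [1/y] at [z] is [(y - z)^2 / (y z^2)]. The first bound keeps [|y| > m/2]; the
     second then gives [|y - z| <= eps |y| m^2]. *)
  assert (Hd : 0 < Rmin (m / 2) (eps * m ^ 3 / 2)).
  { apply Rmin_pos; [lra |]. assert (0 < m ^ 3) by now apply pow_lt.
    assert (0 < eps) by apply cond_pos. nra. }
  exists (mkposreal _ Hd). simpl. intros y Hy.
  assert (Hy1 := Rlt_le_trans _ _ _ Hy (Rmin_l _ _)).
  assert (Hy2 := Rlt_le_trans _ _ _ Hy (Rmin_r _ _)).
  assert (Hmy : m / 2 < Cmod y).
  { assert (T := Cmod_triangle_inv z y).
    replace (z - y)%C with (- (y - z))%C in T by ring. rewrite Cmod_opp in T.
    fold m in T. lra. }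
  assert (Hy0 : y <> 0%C) by (apply Cmod_gt_0; lra).
  replace (/ y - / z - (y - z) * - / (z * z))%C
    with ((y - z) * ((y - z) * / (y * (z * z))))%C by (field; repeat split; auto).
  rewrite !Cmod_mult, Cmod_inv, !Cmod_mult by (repeat apply Cmult_neq_0; auto).
  fold m. rewrite (Rmult_comm eps). apply Rmult_le_compat_l; [apply Cmod_ge_0 |].
  assert (HP : 0 < Cmod y * (m * m)) by (repeat apply Rmult_lt_0_compat; lra).
  apply Rmult_le_reg_r with (1 := HP). rewrite Rmult_assoc, Rinv_l by lra.
  assert (0 < eps) by apply cond_pos.
  assert (eps * (m ^ 3 / 2) <= eps * (Cmod y * (m * m))).
  { apply Rmult_le_compat_l; [lra |]. simpl. nra. }
  lra.
Qed.

(** Continuity of [h'] is part of the notion, since the circle means are differentiated under the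
    integral sign. The domain is a parameter because both the disc and the punctured disc occur. *)
Definition hol (D : C -> Prop) (h : C -> C) : Prop :=
  exists h' : C -> C, forall z, D z -> cderiv h z (h' z) /\ ccont h' z.

Lemma hol_const (D : C -> Prop) (c : C) : hol D (fun _ => c).
Proof. exists (fun _ => 0%C). intros z _. split; [apply cderiv_const | apply ccont_const]. Qed.

Lemma hol_id (D : C -> Prop) : hol D (fun z => z).
Proof. exists (fun _ => 1%C). intros z _. split; [apply cderiv_id | apply ccont_const]. Qed.

Lemma hol_plus (D : C -> Prop) (f g : C -> C) :
  hol D f -> hol D g -> hol D (fun z => f z + g z)%C.
Proof.
  intros [f' Hf] [g' Hg]. exists (fun z => f' z + g' z)%C. intros z Hz.
  destruct (Hf z Hz), (Hg z Hz). split; [now apply cderiv_plus | now apply ccont_plus].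
Qed.

Lemma hol_mult (D : C -> Prop) (f g : C -> C) :
  hol D f -> hol D g -> hol D (fun z => f z * g z)%C.
Proof.
  intros [f' Hf] [g' Hg]. exists (fun z => f' z * g z + f z * g' z)%C. intros z Hz.
  destruct (Hf z Hz), (Hg z Hz).
  assert (ccont f z) by now apply cderiv_cont with (f' z).
  assert (ccont g z) by now apply cderiv_cont with (g' z).
  split; [now apply cderiv_mult |].
  apply ccont_plus; now apply ccont_mult.
Qed.

Lemma hol_sub (D D' : C -> Prop) (f : C -> C) :
  (forall z, D' z -> D z) -> hol D f -> hol D' f.
Proof. intros H [f' Hf]. exists f'. intros z Hz. apply Hf, H, Hz. Qed.

Lemma hol_Cinv (D : C -> Prop) : (forall z, D z -> z <> 0%C) -> hol D Cinv.
Proof.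
  intros H. exists (fun z => (-(1)) * (/ z * / z))%C. intros z Hz.
  assert (Hz0 := H z Hz). assert (Hi := cderiv_Cinv z Hz0). split.
  - apply (cderiv_eq _ _ _ _ Hi). now field.
  - apply cderiv_cont in Hi. apply ccont_mult; [apply ccont_const | now apply ccont_mult].
Qed.

Lemma Cmod_le_Rabs (x y : R) : Cmod (x, y) <= Rabs x + Rabs y.
Proof.
  replace ((x, y) : C) with (RtoC x + RtoC y * Ci)%C.
  - eapply Rle_trans; [apply Cmod_triangle |].
    rewrite Cmod_mult, Cmod_Ci, !Cmod_R. lra.
  - unfold RtoC, Ci, Cplus, Cmult. simpl. f_equal; ring.
Qed.

Lemma im_le_Cmod (c : C) : Rabs (Im c) <= Cmod c.
Proof. eapply Rle_trans; [apply Rmax_r |]. apply Rmax_Cmod. Qed.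

(** * The complex exponential *)

Lemma Cexp_plus (a b : C) : Cexp (a + b)%C = (Cexp a * Cexp b)%C.
Proof.
  destruct a as [a1 a2], b as [b1 b2]. unfold Cexp, Cplus, Cmult; simpl.
  rewrite exp_plus, cos_plus, sin_plus. f_equal; ring.
Qed.

Lemma Cexp_0 : Cexp 0%C = 1%C.
Proof. unfold Cexp, RtoC; simpl. rewrite exp_0, cos_0, sin_0. f_equal; ring. Qed.

Lemma Cexp_neq_0 (z : C) : Cexp z <> 0%C.
Proof.
  intros H. assert (E : (Cexp z * Cexp (- z))%C = 1%C).
  { rewrite <- Cexp_plus, <- Cexp_0. f_equal. ring. }
  rewrite H, Cmult_0_l in E. now apply C1_nz.
Qed.

Lemma is_derive_at_0 (f : R -> R) (l : R) (eps : posreal) :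
  is_derive f 0 l -> exists d : posreal, forall x, Rabs x < d ->
    Rabs (f x - f 0 - x * l) <= eps * Rabs x.
Proof.
  intros [_ H]. destruct (H 0 (fun P HP => HP) eps) as [d Hd].
  exists d. intros x Hx.
  assert (T := Hd x). unfold ball, minus, plus, opp, scal, norm, mult, abs in T; simpl in T.
  unfold AbsRing_ball, minus, plus, opp, scal, norm, mult, abs in T; simpl in T.
  unfold mult in T; simpl in T.
  replace (x + - 0) with x in T by ring. apply T, Hx.
Qed.

Lemma cderiv_Cexp_0 : cderiv Cexp 0%C 1%C.
Proof.
  apply cderiv_iff. intros eps0.
  assert (He0 := cond_pos eps0).
  (* The real and the imaginary part of the remainder each cost [3 * eps * m], hence the 6. The cap
     at 1 serves the crude bounds [|1 + x| <= 2] and [|sin y| <= 2 m]. *)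
  assert (He : 0 < Rmin 1 (eps0 / 6)) by (apply Rmin_pos; lra).
  set (eps := mkposreal _ He).
  assert (L1 : eps <= 1) by apply Rmin_l. assert (L2 : eps <= eps0 / 6) by apply Rmin_r.
  destruct (is_derive_at_0 exp 1 eps) as [d1 H1].
  { auto_derive; auto. rewrite exp_0; ring. }
  destruct (is_derive_at_0 cos 0 eps) as [d2 H2].
  { auto_derive; auto. rewrite sin_0; ring. }
  destruct (is_derive_at_0 sin 1 eps) as [d3 H3].
  { auto_derive; auto. rewrite cos_0; ring. }
  rewrite exp_0 in H1. rewrite cos_0 in H2. rewrite sin_0 in H3.
  clearbody eps.
  assert (Hd : 0 < Rmin (Rmin d1 d2) (Rmin d3 (eps / 2))).
  { assert (0 < eps) by apply cond_pos.
    repeat apply Rmin_pos; try apply cond_pos; lra. }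
  exists (mkposreal _ Hd). simpl. intros [x y] Hy.
  rewrite Cexp_0.
  replace ((x, y) - 0)%C with ((x, y) : C) in *
    by (unfold Cminus, Cplus, Copp, RtoC; simpl; f_equal; ring).
  replace (Cexp (x, y) - 1 - (x, y) * 1)%C
    with ((exp x * cos y - 1 - x, exp x * sin y - y) : C)
    by (unfold Cexp, Cminus, Cplus, Copp, Cmult, RtoC; simpl; f_equal; ring).
  assert (Hx := re_le_Cmod (x, y)). assert (Hyy := im_le_Cmod (x, y)).
  simpl in Hx, Hyy.
  apply Rmin_Rgt_l in Hy. destruct Hy as [Ha Hb].
  apply Rmin_Rgt_l in Ha. apply Rmin_Rgt_l in Hb.
  destruct Ha as [Ha1 Ha2], Hb as [Hb1 Hb2].
  set (m := Cmod (x, y)) in *.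
  assert (A1 : Rabs (exp x - 1 - x * 1) <= eps * Rabs x) by (apply H1; lra).
  assert (A2 : Rabs (cos y - 1 - y * 0) <= eps * Rabs y) by (apply H2; lra).
  assert (A3 : Rabs (sin y - 0 - y * 1) <= eps * Rabs y) by (apply H3; lra).
  assert (Hc : Rabs (cos y) <= 1) by (apply Rabs_le, COS_bound).
  assert (He' := cond_pos eps).
  eapply Rle_trans; [apply Cmod_le_Rabs |].
  assert (B1 : Rabs (exp x * cos y - 1 - x) <= 3 * eps * m).
  { replace (exp x * cos y - 1 - x)
      with ((exp x - 1 - x * 1) * cos y + (1 + x) * (cos y - 1 - y * 0)) by ring.
    eapply Rle_trans; [apply Rabs_triang |]. rewrite !Rabs_mult.
    assert (Rabs (1 + x) <= 2).
    { eapply Rle_trans; [apply Rabs_triang |]. rewrite Rabs_R1. lra. }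
    assert (Rabs (exp x - 1 - x * 1) * Rabs (cos y) <= (eps * m) * 1).
    { apply Rmult_le_compat; try apply Rabs_pos; nra. }
    assert (Rabs (1 + x) * Rabs (cos y - 1 - y * 0) <= 2 * (eps * m)).
    { apply Rmult_le_compat; try apply Rabs_pos; nra. }
    lra. }
  assert (B2 : Rabs (exp x * sin y - y) <= 3 * eps * m).
  { assert (E1 : Rabs (exp x - 1) <= eps).
    { replace (exp x - 1) with ((exp x - 1 - x * 1) + x) by ring.
      eapply Rle_trans; [apply Rabs_triang |].
      assert (Rabs x <= eps / 2) by lra. assert (0 <= Rabs x) by apply Rabs_pos. nra. }
    assert (S : Rabs (sin y) <= 2 * m).
    { replace (sin y) with ((sin y - 0 - y * 1) + y) by ring.
      eapply Rle_trans; [apply Rabs_triang |].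
      assert (eps * Rabs y <= 1 * m) by (apply Rmult_le_compat; try apply Rabs_pos; lra).
      lra. }
    replace (exp x * sin y - y)
      with ((sin y - 0 - y * 1) + (exp x - 1) * sin y) by ring.
    eapply Rle_trans; [apply Rabs_triang |]. rewrite Rabs_mult.
    assert (Rabs (exp x - 1) * Rabs (sin y) <= eps * (2 * m)).
    { apply Rmult_le_compat; try apply Rabs_pos; lra. }
    nra. }
  assert (0 <= m) by apply Cmod_ge_0.
  nra.
Qed.

(** The functional equation [e^x = e^z e^(x - z)] moves the derivative at 0 to any point. *)
Lemma cderiv_Cexp (z : C) : cderiv Cexp z (Cexp z).
Proof.
  assert (H : cderiv (fun x => Cexp z * Cexp (x + (- z)))%C z
                (0 * Cexp (z + (- z)) + Cexp z * ((1 + 0) * 1))%C).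
  { apply (cderiv_mult (fun _ => Cexp z) (fun x => Cexp (x + (- z))%C));
      [apply cderiv_const |].
    apply (cderiv_comp Cexp (fun x => x + (- z))%C).
    - cbv beta. replace (z + - z)%C with (RtoC 0) by ring. apply cderiv_Cexp_0.
    - apply cderiv_plus; [apply cderiv_id | apply cderiv_const]. }
  apply (cderiv_ext_loc _ Cexp _ _ (mkposreal 1 Rlt_0_1)) in H.
  - apply (cderiv_eq _ _ _ _ H). ring.
  - intros y _. rewrite <- Cexp_plus. f_equal. ring.
Qed.

(** * Complex power series on the unit disc *)

Lemma ex_series_Rabs_le (u b : nat -> R) :
  (forall n, Rabs (u n) <= b n) -> ex_series b -> ex_series u.
Proof. apply (@ex_series_le R_AbsRing R_CompleteNormedModule). Qed.

Definition cseries (u : nat -> C) (L : C) : Prop :=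
  @is_series C_AbsRing C_NormedModule u L.

Lemma Re_sum_n (u : nat -> C) (n : nat) :
  Re (@sum_n C_NormedModule u n) = sum_n (fun k => Re (u k)) n.
Proof.
  induction n as [|n IH]; [now rewrite !sum_O |].
  rewrite !sum_Sn, <- IH. reflexivity.
Qed.

Lemma Im_sum_n (u : nat -> C) (n : nat) :
  Im (@sum_n C_NormedModule u n) = sum_n (fun k => Im (u k)) n.
Proof.
  induction n as [|n IH]; [now rewrite !sum_O |].
  rewrite !sum_Sn, <- IH. reflexivity.
Qed.

(** The balls of [C_UniformSpace] are products of real balls, so convergence splits into coordinates
    and real series results become available. *)
Lemma cseries_iff (u : nat -> C) (L : C) :
  cseries u L <->
  is_series (fun n => Re (u n)) (Re L) /\ is_series (fun n => Im (u n)) (Im L).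
Proof.
  assert (E := @filterlim_locally nat C_UniformSpace eventually (@filter_filter _ _ eventually_filter)
                 (@sum_n C_NormedModule u) L).
  split.
  - intros H. assert (H' := proj1 E H).
    split; apply filterlim_locally; intros eps; generalize (H' eps); apply filter_imp;
      intros n Hn; [rewrite <- Re_sum_n | rewrite <- Im_sum_n]; apply Hn.
  - intros [H1 H2]. apply (proj2 E). intros eps.
    generalize (filter_and _ _ (proj1 (filterlim_locally _ _) H1 eps)
                  (proj1 (filterlim_locally _ _) H2 eps)).
    apply filter_imp. intros n [Hn1 Hn2].
    rewrite <- Re_sum_n in Hn1. rewrite <- Im_sum_n in Hn2. split; assumption.
Qed.

Lemma cseries_plus (u v : nat -> C) (U V : C) :
  cseries u U -> cseries v V -> cseries (fun n => u n + v n)%C (U + V)%C.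
Proof. apply (@is_series_plus C_AbsRing C_NormedModule). Qed.

Lemma cseries_scal (c : C) (u : nat -> C) (U : C) :
  cseries u U -> cseries (fun n => c * u n)%C (c * U)%C.
Proof. apply (@is_series_scal C_AbsRing C_NormedModule c). Qed.

Lemma cseries_ext (u v : nat -> C) (U : C) :
  (forall n, u n = v n) -> cseries u U -> cseries v U.
Proof. apply (@is_series_ext C_AbsRing C_NormedModule). Qed.

Lemma cseries_S (u : nat -> C) (U : C) :
  cseries (fun n => u (S n)) U -> cseries u (u O + U)%C.
Proof.
  intros H. apply (@is_series_decr_1 C_AbsRing C_NormedModule).
  match goal with |- is_series _ ?l => replace l with U end; auto.
  unfold plus, opp; simpl. unfold Cplus, Copp; destruct U, (u O); simpl. f_equal; ring.
Qed.

(** The factor 2 comes from treating real and imaginary parts separately; it is harmless, because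
    every application asks only for some finite constant. *)
Lemma cseries_Cmod_le (u : nat -> C) (b : nat -> R) (U : C) (B : R) :
  cseries u U -> (forall n, Cmod (u n) <= b n) -> is_series b B -> Cmod U <= 2 * B.
Proof.
  intros HU Hb HB. apply cseries_iff in HU. destruct HU as [H1 H2].
  assert (EB := is_series_unique _ _ HB). assert (HexB : ex_series b) by now exists B.
  assert (key : forall (v : nat -> R) V, is_series v V -> (forall n, Rabs (v n) <= b n) ->
                  Rabs V <= B).
  { intros v V HV Hv. rewrite <- (is_series_unique _ _ HV), <- EB.
    assert (Hex : ex_series (fun n => Rabs (v n))).
    { apply ex_series_Rabs_le with b; auto.
      intros n. rewrite Rabs_Rabsolu. apply Hv. }
    eapply Rle_trans; [now apply Series_Rabs |].
    apply Series_le; auto. intros n. split; [apply Rabs_pos | apply Hv]. }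
  assert (R1 := key _ _ H1 (fun n => Rle_trans _ _ _ (re_le_Cmod (u n)) (Hb n))).
  assert (R2 := key _ _ H2 (fun n => Rle_trans _ _ _ (im_le_Cmod (u n)) (Hb n))).
  destruct U as [x y]. unfold Re, Im in *; simpl in *.
  assert (T := Cmod_le_Rabs x y). lra.
Qed.

Lemma one_minus_neq_0 (x : C) : Cmod x < 1 -> (1 - x)%C <> 0%C.
Proof.
  intros Hx E. assert (H : x = 1%C) by (rewrite <- (Cplus_0_r x), <- E; ring).
  rewrite H, Cmod_1 in Hx. lra.
Qed.

Lemma cseries_geom (x : C) : Cmod x < 1 -> cseries (fun n => x ^ n)%C (/ (1 - x))%C.
Proof.
  intros Hx.
  assert (Hx1 := one_minus_neq_0 x Hx).
  assert (Hp : 0 < Cmod (1 - x)%C) by now apply Cmod_gt_0.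
  assert (Hs : forall n, @sum_n C_NormedModule (fun n => (x ^ n)%C) n
                         = (/ (1 - x) * (1 - x ^ S n))%C).
  { induction n as [|n IH].
    - rewrite sum_O. simpl. now field.
    - rewrite sum_Sn, IH. unfold plus; simpl. now field. }

  apply (proj2 (@filterlim_locally nat C_UniformSpace eventually (@filter_filter _ _ eventually_filter)
                 (@sum_n C_NormedModule (fun n => (x ^ n)%C)) _)). intros eps.
  destruct (pow_lt_1_zero (Cmod x)) with (y := eps * Cmod (1 - x)%C) as [N HN].
  { rewrite Rabs_pos_eq; auto. apply Cmod_ge_0. }
  { apply Rmult_lt_0_compat; auto. apply cond_pos. }
  exists N. intros n Hn. apply C_NormedModule_mixin_compat1.
  rewrite Hs. unfold minus, plus, opp; simpl.
  replace (/ (1 - x) * (1 - x * x ^ n) + - / (1 - x))%C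
    with (- (/ (1 - x) * (x ^ S n)))%C by (simpl; now field).
  rewrite Cmod_opp, Cmod_mult, Cmod_inv, Cmod_pow by auto.
  apply Rmult_lt_reg_l with (1 := Hp).
  rewrite <- Rmult_assoc, Rinv_r, Rmult_1_l by lra.
  rewrite Rmult_comm. eapply Rle_lt_trans; [apply Rle_abs |]. apply HN. lia.
Qed.

Definition cpseries (a : nat -> C) (z L : C) : Prop := cseries (fun n => z ^ n * a n)%C L.

Lemma pow_n_Cpow (z : C) (n : nat) : @pow_n C_Ring z n = (z ^ n)%C.
Proof. induction n as [|n IH]; [reflexivity |]. simpl. now rewrite IH. Qed.

Lemma is_pseries_iff (a : nat -> C) (z L : C) :
  @is_pseries C_AbsRing C_NormedModule a z L <-> cpseries a z L.
Proof.
  unfold is_pseries, cpseries. split; apply cseries_ext; intros n;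
    unfold scal; simpl; unfold mult; simpl; now rewrite <- pow_n_Cpow.
Qed.

(** Equivalently, the radius of convergence is at least 1. Only moduli enter, so shifted and
    differentiated series inherit the property by comparison. *)
Definition absconv (a : nat -> C) : Prop :=
  forall r, 0 <= r < 1 -> ex_series (fun n => Cmod (a n) * r ^ n).

Definition psum (a : nat -> C) (z : C) : C :=
  (Series (fun n => Re (z ^ n * a n)%C), Series (fun n => Im (z ^ n * a n)%C)).

Lemma cpseries_psum_of_absconv (a : nat -> C) (z : C) :
  absconv a -> Cmod z < 1 -> cpseries a z (psum a z).
Proof.
  intros Ha Hz. apply cseries_iff.
  change (Re (psum a z)) with (Series (fun n => Re (z ^ n * a n)%C)).
  change (Im (psum a z)) with (Series (fun n => Im (z ^ n * a n)%C)).
  assert (Hex := Ha (Cmod z) (conj (Cmod_ge_0 z) Hz)).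
  split; apply Series_correct; apply ex_series_Rabs_le with (2 := Hex); intros n.
  - eapply Rle_trans; [apply re_le_Cmod |]. rewrite Cmod_mult, Cmod_pow. lra.
  - eapply Rle_trans; [apply im_le_Cmod |]. rewrite Cmod_mult, Cmod_pow. lra.
Qed.

Lemma cpseries_psum (a : nat -> C) (z L : C) : cpseries a z L -> psum a z = L.
Proof.
  intros H. apply cseries_iff in H. destruct H as [H1 H2]. unfold psum.
  rewrite (is_series_unique _ _ H1), (is_series_unique _ _ H2). now destruct L.
Qed.

Lemma ex_series_bounded (u : nat -> R) :
  ex_series u -> exists M, 0 < M /\ forall n, Rabs (u n) <= M.
Proof.
  intros H. apply ex_series_lim_0, is_lim_seq_Reals in H.
  apply maj_by_pos. now exists 0.
Qed.

(** Abel's lemma: boundedness at a radius [s] strictly between [r] and 1 gives domination by the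
    geometric series of ratio [r / s]. *)
Lemma absconv_of_bound (a : nat -> C) :
  (forall s, 0 < s < 1 -> exists M, forall n, Cmod (a n) * s ^ n <= M) -> absconv a.
Proof.
  intros H r Hr. destruct (H ((1 + r) / 2)) as [M HM]; [lra |].
  set (s := (1 + r) / 2) in *. assert (Hs : r < s < 1) by (unfold s; lra).
  assert (Hq : Rabs (r / s) < 1).
  { rewrite Rabs_pos_eq.
    - apply Rmult_lt_reg_r with s; [lra |]. field_simplify; lra.
    - apply Rmult_le_pos; [lra |]. apply Rlt_le, Rinv_0_lt_compat. lra. }
  apply ex_series_Rabs_le with (fun n => M * (r / s) ^ n).
  - intros n.
    assert (0 <= r ^ n) by (apply pow_le; lra).
    assert (0 < s ^ n) by (apply pow_lt; lra).
    rewrite Rabs_pos_eq by (apply Rmult_le_pos; auto; apply Cmod_ge_0).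
    replace (Cmod (a n) * r ^ n) with ((Cmod (a n) * s ^ n) * (r / s) ^ n).
    + apply Rmult_le_compat_r; auto. apply pow_le.
      apply Rmult_le_pos; [lra |]. apply Rlt_le, Rinv_0_lt_compat. lra.
    + unfold Rdiv. rewrite Rpow_mult_distr, pow_inv. field. lra.
  - apply (@ex_series_scal R_AbsRing R_NormedModule). exists (/ (1 - r / s)).
    now apply is_series_geom.
Qed.

Lemma absconv_of_cpseries (a : nat -> C) :
  (forall z, Cmod z < 1 -> exists L, cpseries a z L) -> absconv a.
Proof.
  intros H. apply absconv_of_bound. intros s Hs.
  destruct (H (RtoC s)) as [L HL].
  { rewrite Cmod_R, Rabs_pos_eq; lra. }
  apply cseries_iff in HL. destruct HL as [H1 H2].
  destruct (ex_series_bounded _ (ex_intro _ _ H1)) as [M1 [_ HM1]].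
  destruct (ex_series_bounded _ (ex_intro _ _ H2)) as [M2 [_ HM2]].
  exists (M1 + M2). intros n.
  assert (Hsn : 0 <= s ^ n) by (apply pow_le; lra).
  replace (Cmod (a n) * s ^ n) with (Cmod (RtoC s ^ n * a n)%C).
  - specialize (HM1 n). specialize (HM2 n). destruct (RtoC s ^ n * a n)%C as [x y].
    unfold Re, Im in *; simpl in *. assert (T := Cmod_le_Rabs x y). lra.
  - rewrite Cmod_mult, Cmod_pow, Cmod_R, (Rabs_pos_eq s) by lra. ring.
Qed.

Lemma absconv_bound (a : nat -> C) (s : R) :
  absconv a -> 0 <= s < 1 -> exists M, forall n, Cmod (a n) * s ^ n <= M.
Proof.
  intros Ha Hs. destruct (ex_series_bounded _ (Ha s Hs)) as [M [_ HM]].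
  exists M. intros n. eapply Rle_trans; [apply Rle_abs | apply HM].
Qed.

(** * Termwise differentiation *)

Lemma absconv_shift (a : nat -> C) : absconv a -> absconv (fun n => a (S n)).
Proof.
  intros Ha. apply absconv_of_bound. intros s Hs.
  destruct (absconv_bound a s Ha) as [M HM]; [lra |].
  exists (M / s). intros n. apply Rmult_le_reg_r with s; [lra |].
  replace (M / s * s) with M by (field; lra).
  specialize (HM (S n)). simpl in HM. lra.
Qed.

(** Bernoulli's inequality for [(1 + x)^n] with [1 + x = / s]. *)
Lemma pow_linear_bound (s : R) : 0 < s < 1 -> exists K, forall n, INR n * s ^ n <= K.
Proof.
  intros Hs. set (x := / s - 1).
  assert (Hx : 0 < x).
  { unfold x. apply Rlt_0_minus. rewrite <- Rinv_1. apply Rinv_lt_contravar; lra. }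
  exists (/ x). intros n. assert (P := poly n x Hx).
  replace (1 + x) with (/ s) in P by (unfold x; ring).
  rewrite pow_inv in P. assert (Hn : 0 < s ^ n) by (apply pow_lt; lra).
  apply Rmult_le_reg_r with x; auto. rewrite Rinv_l by lra.
  apply Rmult_le_compat_r with (r := s ^ n) in P; [| lra].
  rewrite Rinv_l in P by (apply Rgt_not_eq; exact Hn).
  replace (INR n * s ^ n * x) with (INR n * x * s ^ n) by ring. lra.
Qed.

(** The weight [n^2] is that of the second-order remainder of [z^n]. If [r <= s^3] with [s < 1],
    then [n^2 r^n <= (n s^n)^2 s^n], and [n s^n] is bounded. *)
Lemma absconv_sqr (a : nat -> C) (r : R) :
  absconv a -> 0 <= r < 1 -> ex_series (fun n => Cmod (a n) * (INR n ^ 2 * r ^ n)).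
Proof.
  (* This [s] satisfies [r = 3 s - 2], the tangent of [s^3] at 1; thus
     [s^3 - r = (s - 1)^2 (s + 2) >= 0]. *)
  intros Ha Hr. set (s := 1 - (1 - r) / 3).
  assert (Hs : 0 < s < 1) by (unfold s; lra).
  assert (Hrs : r <= s ^ 3)
    by (replace r with (3 * s - 2) by (unfold s; field);
        assert (0 <= (s - 1) ^ 2 * (s + 2)) by (apply Rmult_le_pos; [apply pow2_ge_0 | lra]);
        simpl in *; nra).
  destruct (pow_linear_bound s Hs) as [K HK].
  apply ex_series_Rabs_le with (fun n => K ^ 2 * (Cmod (a n) * s ^ n)).
  - intros n.
    assert (Hm := Cmod_ge_0 (a n)). assert (0 <= r ^ n) by (apply pow_le; lra).
    assert (0 <= INR n) by apply pos_INR. assert (0 <= s ^ n) by (apply pow_le; lra).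
    rewrite Rabs_pos_eq.
    2:{ apply Rmult_le_pos; auto. apply Rmult_le_pos; auto. now apply pow_le. }
    replace (K ^ 2 * (Cmod (a n) * s ^ n)) with (Cmod (a n) * (K ^ 2 * s ^ n)) by ring.
    apply Rmult_le_compat_l; auto.
    apply Rle_trans with ((INR n * s ^ n) ^ 2 * s ^ n).
    + replace ((INR n * s ^ n) ^ 2 * s ^ n) with (INR n ^ 2 * (s ^ n) ^ 3) by ring.
      apply Rmult_le_compat_l; [now apply pow_le |].
      rewrite <- pow_mult, Nat.mul_comm, pow_mult. now apply pow_incr.
    + apply Rmult_le_compat_r; auto. apply pow_incr. split; auto. now apply Rmult_le_pos.
  - apply (@ex_series_scal R_AbsRing R_NormedModule). apply Ha. lra.
Qed.

Definition dcoef (a : nat -> C) (n : nat) : C := (RtoC (INR (S n)) * a (S n))%C.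

Lemma absconv_dcoef (a : nat -> C) : absconv a -> absconv (dcoef a).
Proof.
  intros Ha. apply absconv_of_bound. intros s Hs.
  destruct (ex_series_bounded _ (absconv_sqr a s Ha (conj (Rlt_le _ _ (proj1 Hs)) (proj2 Hs))))
    as [M [_ HM]].
  exists (M / s). intros n. apply Rmult_le_reg_r with s; [lra |].
  replace (M / s * s) with M by (field; lra).
  eapply Rle_trans; [| apply (HM (S n))]. eapply Rle_trans; [| apply Rle_abs].
  unfold dcoef. rewrite Cmod_mult, Cmod_R, (Rabs_pos_eq (INR _)) by apply pos_INR.
  replace (INR (S n) * Cmod (a (S n)) * s ^ n * s) with (INR (S n) * Cmod (a (S n)) * s ^ S n)
    by (simpl pow; ring).
  assert (1 <= INR (S n)) by (rewrite S_INR; assert (T := pos_INR n); lra).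
  assert (P : 0 <= Cmod (a (S n)) * s ^ S n)
    by (apply Rmult_le_pos; [apply Cmod_ge_0 | apply pow_le; lra]).
  set (X := Cmod (a (S n))) in *. set (Y := s ^ S n) in *. set (m := INR (S n)) in *.
  replace (X * (m ^ 2 * Y)) with (m * (m * (X * Y))) by ring.
  rewrite Rmult_assoc. apply Rmult_le_compat_l; [lra |].
  rewrite <- (Rmult_1_l (X * Y)) at 1. now apply Rmult_le_compat_r.
Qed.

(** The remainders satisfy [e_(m+1) = y e_m + m (y - z)^2 z^(m-1)], and the induction closes because
    [m^2 + m <= (m + 1)^2]. Keeping [r ^ 2] on the left avoids the exponent [m - 2] on the right. *)
Lemma pow_taylor_bound (y z : C) (r : R) (n : nat) :
  Cmod y <= r -> Cmod z <= r ->
  Cmod (y ^ S n - z ^ S n - (y - z) * (RtoC (INR (S n)) * z ^ n))%C * r ^ 2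
    <= Cmod (y - z)%C ^ 2 * (INR (S n) ^ 2 * r ^ S n).
Proof.
  intros Hy Hz. assert (Hr : 0 <= r) by (eapply Rle_trans; [apply Cmod_ge_0 | apply Hy]).
  assert (Hd := Cmod_ge_0 (y - z)%C). induction n as [|n IH].
  - replace (y ^ 1 - z ^ 1 - (y - z) * (RtoC (INR 1) * z ^ 0))%C with (RtoC 0)
      by (simpl; ring).
    rewrite Cmod_0. simpl. nra.
  - assert (Hn := pos_INR (S n)). rewrite (S_INR (S n)).
    set (m := INR (S n)) in *.
    replace (y ^ S (S n) - z ^ S (S n) - (y - z) * (RtoC (m + 1) * z ^ S n))%C
      with (y * (y ^ S n - z ^ S n - (y - z) * (RtoC m * z ^ n))
            + RtoC m * ((y - z) * (y - z)) * z ^ n)%C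
      by (rewrite RtoC_plus; simpl; ring).
    set (e := (y ^ S n - z ^ S n - (y - z) * (RtoC m * z ^ n))%C) in *.
    assert (T := Cmod_triangle (y * e) (RtoC m * ((y - z) * (y - z)) * z ^ n)).
    rewrite !Cmod_mult, Cmod_R, (Rabs_pos_eq m), Cmod_pow in T by auto.
    set (d := Cmod (y - z)%C) in *.
    assert (Hzn : Cmod z ^ n <= r ^ n) by (apply pow_incr; split; auto; apply Cmod_ge_0).
    assert (Hrn : 0 <= r ^ n) by now apply pow_le.
    assert (0 <= Cmod e) by apply Cmod_ge_0.
    assert (T1 : Cmod y * Cmod e * r ^ 2 <= r * (d ^ 2 * (m ^ 2 * r ^ S n))).
    { rewrite Rmult_assoc. apply Rmult_le_compat; auto; [apply Cmod_ge_0 |].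
      apply Rmult_le_pos; auto. now apply pow_le. }
    assert (T2 : m * (d * d) * Cmod z ^ n * r ^ 2 <= m * (d * d) * r ^ n * r ^ 2).
    { apply Rmult_le_compat_r; [now apply pow_le |].
      apply Rmult_le_compat_l; auto. apply Rmult_le_pos; auto. nra. }
    apply Rle_trans with (r * (d ^ 2 * (m ^ 2 * r ^ S n)) + m * (d * d) * r ^ n * r ^ 2).
    + assert (0 <= r ^ 2) by now apply pow_le. nra.
    + assert (X : 0 <= d ^ 2 * (r ^ n * r ^ 2) * (m + 1)).
      { apply Rmult_le_pos; [| lra]. apply Rmult_le_pos; [now apply pow_le |].
        apply Rmult_le_pos; auto. now apply pow_le. }
      simpl in *. nra.
Qed.

(** Summing [pow_taylor_bound] over a disc of radius [r] between [|z|] and 1 bounds the remainder of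
    the whole series by [K |y - z|^2]. *)
Lemma cderiv_psum (a : nat -> C) (z : C) :
  absconv a -> Cmod z < 1 -> cderiv (psum a) z (psum (dcoef a) z).
Proof.
  intros Ha Hz. apply cderiv_iff. intros eps.
  assert (Hz0 := Cmod_ge_0 z). assert (He := cond_pos eps).
  set (r := (1 + Cmod z) / 2).
  assert (Hr : Cmod z < r < 1) by (unfold r; lra).
  assert (Hr2 : 0 < r ^ 2) by (apply pow_lt; lra).
  assert (Hex := absconv_sqr a r Ha (conj (Rle_trans _ _ _ Hz0 (Rlt_le _ _ (proj1 Hr))) (proj2 Hr))).
  set (M := Series (fun n => Cmod (a n) * (INR n ^ 2 * r ^ n))).
  apply Series_correct in Hex. fold M in Hex.
  assert (HM : 0 <= 2 * M / r ^ 2).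
  { assert (Cmod 0 <= 2 * M).
    { apply (cseries_Cmod_le (fun _ => RtoC 0)
               (fun n => Cmod (a n) * (INR n ^ 2 * r ^ n))); auto.
      - apply cseries_iff. unfold Re, Im; simpl. split; apply is_series_Reals;
          intros e He0; exists O; intros n _; rewrite sum_cte; unfold Rdist;
          replace (0 * INR (S n) - 0) with 0 by ring; rewrite Rabs_R0; exact He0.
      - intros n. rewrite Cmod_0. apply Rmult_le_pos; [apply Cmod_ge_0 |].
        apply Rmult_le_pos; [apply pow_le, pos_INR | apply pow_le; lra]. }
    rewrite Cmod_0 in H. apply Rmult_le_pos; auto.
    now apply Rlt_le, Rinv_0_lt_compat. }
  set (K := 2 * M / r ^ 2) in *.
  assert (Hd : 0 < Rmin (r - Cmod z) (eps / (K + 1))).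
  { apply Rmin_pos; [lra |]. apply Rdiv_lt_0_compat; lra. }
  exists (mkposreal _ Hd). simpl. intros y Hy. apply Rmin_Rgt_l in Hy. destruct Hy as [Hy1 Hy2].
  set (d := Cmod (y - z)%C) in *. assert (Hd0 : 0 <= d) by apply Cmod_ge_0.
  assert (Hyr : Cmod y <= r).
  { assert (T := Cmod_triangle_inv y z). fold d in T. lra. }
  assert (B : Cmod (psum a y - psum a z - (y - z) * psum (dcoef a) z)%C
              <= 2 * (d ^ 2 / r ^ 2 * M)).
  (* The constant terms cancel, so slot 0 is 0; slot [S m] carries the remainder of the power [S m],
     which realigns the series of [dcoef a] with that of [a]. *)
  { apply cseries_Cmod_le with
      (u := fun n => match n with O => RtoC 0 | S m =>
         ((y ^ S m - z ^ S m - (y - z) * (RtoC (INR (S m)) * z ^ m)) * a (S m))%C end)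
      (b := fun n => d ^ 2 / r ^ 2 * (Cmod (a n) * (INR n ^ 2 * r ^ n))).
    - assert (S1 := cpseries_psum_of_absconv a y Ha ltac:(lra)).
      assert (S2 := cpseries_psum_of_absconv a z Ha Hz).
      assert (S3 := cpseries_psum_of_absconv _ z (absconv_dcoef a Ha) Hz).
      assert (S3' : cseries (fun n => match n with O => RtoC 0 | S m => z ^ m * dcoef a m end)%C
                      (0 + psum (dcoef a) z)%C) by now apply cseries_S.
      rewrite Cplus_0_l in S3'.
      replace (psum a y - psum a z - (y - z) * psum (dcoef a) z)%C
        with ((psum a y + - (1) * psum a z) + - (y - z) * psum (dcoef a) z)%C by ring.
      eapply cseries_ext; [| apply cseries_plus; [apply cseries_plus; [exact S1 |] |];
                              apply cseries_scal; [exact S2 | exact S3']].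
      intros [|m]; cbv beta iota; [simpl; ring |]. unfold dcoef. rewrite !Cpow_S. ring.
    - intros [|m].
      + rewrite Cmod_0. simpl. right. ring.
      + rewrite Cmod_mult. apply Rmult_le_reg_r with (1 := Hr2).
        assert (T := pow_taylor_bound y z r m Hyr ltac:(lra)). fold d in T.
        apply Rmult_le_compat_l with (1 := Cmod_ge_0 (a (S m))) in T.
        set (X := Cmod (y ^ S m - _ - _)%C) in *.
        apply Rle_trans with (Cmod (a (S m)) * (X * r ^ 2)); [right; ring |].
        eapply Rle_trans; [exact T |]. right. field. intros E. rewrite E in Hr2. lra.
    - apply (@is_series_scal R_AbsRing R_NormedModule). exact Hex. }
  replace (2 * (d ^ 2 / r ^ 2 * M)) with ((K * d) * d) in B by (unfold K; field; lra).
  eapply Rle_trans; [exact B |]. apply Rmult_le_compat_r; auto.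
  assert ((K + 1) * d <= eps).
  { apply Rle_trans with ((K + 1) * (eps / (K + 1))); [apply Rmult_le_compat_l; lra |].
    right. field. lra. }
  lra.
Qed.

(** * Taylor polynomials and their tails *)

Lemma psum_S (a : nat -> C) (z : C) :
  absconv a -> Cmod z < 1 -> psum a z = (a O + z * psum (fun n => a (S n)) z)%C.
Proof.
  intros Ha Hz. apply cpseries_psum.
  assert (H := cpseries_psum_of_absconv _ z (absconv_shift a Ha) Hz).
  apply (cseries_scal z) in H.
  replace (a O + z * psum (fun n => a (S n)) z)%C
    with (z ^ 0 * a O + z * psum (fun n => a (S n)) z)%C by (simpl; ring).
  apply (cseries_S (fun n => z ^ n * a n)%C).
  eapply cseries_ext; [| exact H]. intros n. simpl. ring.
Qed.

Lemma psum_0 (a : nat -> C) : absconv a -> psum a 0%C = a O.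
Proof. intros Ha. rewrite psum_S; auto; [ring |]. rewrite Cmod_0. lra. Qed.

(** The Taylor polynomial in Horner form: peeling off the constant term, with the rest divisible by
    the variable, is the step on which the inductions over circle means rely. *)
Fixpoint pol (n : nat) (a : nat -> C) (z : C) : C :=
  match n with
  | O => a O
  | S m => (a O + z * pol m (fun k => a (S k)) z)%C
  end.

(** Each use of [psum_S] extracts one factor [z]; the shifted series that is left is bounded on the
    disc of radius [1 / 2]. *)
Lemma psum_pol_bound (n : nat) : forall a : nat -> C, absconv a ->
  exists K, 0 <= K /\ forall z, Cmod z <= 1 / 2 ->
    Cmod (psum a z - pol n a z)%C <= K * Cmod z ^ S n.
Proof.
  assert (Hb : forall a : nat -> C, absconv a -> exists K, 0 <= K /\
             forall z, Cmod z <= 1 / 2 -> Cmod (psum a z) <= K).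
  { intros a Ha. assert (Hex := Ha (1 / 2) ltac:(lra)). destruct Hex as [B HB].
    assert (H : forall z, Cmod z <= 1 / 2 -> Cmod (psum a z) <= 2 * B).
    { intros z Hz.
      apply (cseries_Cmod_le _ (fun n => Cmod (a n) * (1 / 2) ^ n) _ _
               (cpseries_psum_of_absconv a z Ha ltac:(lra))); auto.
      intros k. rewrite Cmod_mult, Cmod_pow, Rmult_comm.
      apply Rmult_le_compat_l; [apply Cmod_ge_0 |].
      apply pow_incr. split; [apply Cmod_ge_0 | auto]. }
    exists (2 * B). split; auto.
    eapply Rle_trans; [apply Cmod_ge_0 | apply (H (RtoC 0))]. rewrite Cmod_0. lra. }
  induction n as [|n IH]; intros a Ha.
  - destruct (Hb _ (absconv_shift a Ha)) as [K [HK HK']]. exists K. split; auto.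
    intros z Hz. rewrite psum_S by (auto; lra). simpl.
    replace (a O + z * psum (fun n => a (S n)) z - a O)%C
      with (psum (fun n => a (S n)) z * z)%C by ring.
    rewrite Cmod_mult, Rmult_1_r. apply Rmult_le_compat_r; auto. apply Cmod_ge_0.
  - destruct (IH _ (absconv_shift a Ha)) as [K [HK HK']]. exists K. split; auto.
    intros z Hz. rewrite psum_S by (auto; lra). simpl pol.
    replace (a O + z * psum (fun n => a (S n)) z - (a O + z * pol n (fun k => a (S k)) z))%C
      with ((psum (fun n => a (S n)) z - pol n (fun k => a (S k)) z) * z)%C by ring.
    rewrite Cmod_mult. specialize (HK' z Hz).
    apply Rmult_le_compat_r with (1 := Cmod_ge_0 z) in HK'.
    eapply Rle_trans; [exact HK' |]. right. simpl. ring.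
Qed.

(** * Mean values on circles and Rogosinski's inequality *)

(** The Cauchy-Riemann equations: both real differentials are read off from multiplication by
    [l]. *)
Lemma cderiv_differentiable_Re (h : C -> C) (x y : R) (l : C) :
  cderiv h (x, y) l ->
  differentiable_pt_lim (fun u v => Re (h (u, v))) x y (Re l) (- Im l) /\
  differentiable_pt_lim (fun u v => Im (h (u, v))) x y (Im l) (Re l).
Proof.
  intros H.
  assert (key : forall eps : posreal, locally_2d (fun u v =>
    Cmod (h (u, v) - h (x, y) - ((u, v) - (x, y)) * l)%C
      <= eps * Rmax (Rabs (u - x)) (Rabs (v - y))) x y).
  { intros eps. assert (He := cond_pos eps).
    (* Halved because [Cmod] is at most twice the maximum norm of [differentiable_pt_lim]. *)
    assert (He2 : 0 < eps / 2) by lra.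
    destruct (proj1 (cderiv_iff h (x, y) l) H (mkposreal _ He2)) as [d Hd].
    assert (Hd2 : 0 < d / 2) by (assert (T := cond_pos d); lra).
    assert (B : forall u v, Cmod ((u, v) - (x, y))%C <= Rabs (u - x) + Rabs (v - y)).
    { intros u v. apply (Cmod_le_Rabs (u - x) (v - y)). }
    exists (mkposreal _ Hd2). simpl. intros u v Hu Hv. specialize (B u v).
    eapply Rle_trans; [apply Hd; lra |]. simpl.
    assert (M1 := Rmax_l (Rabs (u - x)) (Rabs (v - y))).
    assert (M2 := Rmax_r (Rabs (u - x)) (Rabs (v - y))).
    assert (Cmod ((u, v) - (x, y))%C <= 2 * Rmax (Rabs (u - x)) (Rabs (v - y))) by lra.
    apply Rmult_le_compat_l with (r := eps / 2) in H0; lra. }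
  split; intros eps; destruct (key eps) as [d Hd]; exists d; intros u v Hu Hv;
    (eapply Rle_trans; [| apply (Hd u v Hu Hv)]).
  - eapply Rle_trans; [| apply re_le_Cmod]. right. f_equal.
    unfold Re, Im, Cminus, Cplus, Copp, Cmult. simpl. ring.
  - eapply Rle_trans; [| apply im_le_Cmod]. right. f_equal.
    unfold Re, Im, Cminus, Cplus, Copp, Cmult. simpl. ring.
Qed.

Definition circ (r t : R) : C := (r * cos t, r * sin t).

Lemma Cmod_circ (r t : R) : 0 <= r -> Cmod (circ r t) = r.
Proof.
  intros Hr. unfold Cmod, circ. simpl fst. simpl snd.
  replace ((r * cos t) ^ 2 + (r * sin t) ^ 2) with (r ^ 2 * (Rsqr (sin t) + Rsqr (cos t)))
    by (unfold Rsqr; ring).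
  rewrite sin2_cos2, Rmult_1_r. now apply sqrt_pow2.
Qed.

(** Along the radius [h] has derivative [l e^it], along the circle [i r l e^it], and
    [Im (i x) = Re x]. *)
Lemma is_derive_circ (h : C -> C) (r t : R) (l : C) :
  cderiv h (circ r t) l ->
  is_derive (fun u => Re (h (circ u t))) r (Re (l * (cos t, sin t))%C) /\
  is_derive (fun s => Im (h (circ r s))) t (r * Re (l * (cos t, sin t))%C).
Proof.
  intros H. apply cderiv_differentiable_Re in H. destruct H as [H1 H2].
  split; apply is_derive_Reals.
  - replace (Re (l * (cos t, sin t))%C) with (Re l * cos t + - Im l * sin t)
      by (unfold Re, Im, Cmult; simpl; ring).
    apply (derivable_pt_lim_comp_2d (fun u v => Re (h (u, v)))
             (fun u => u * cos t) (fun u => u * sin t)); auto;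
      apply is_derive_Reals; auto_derive; auto; ring.
  - replace (r * Re (l * (cos t, sin t))%C)
      with (Im l * (- (r * sin t)) + Re l * (r * cos t))
      by (unfold Re, Im, Cmult; simpl; ring).
    apply (derivable_pt_lim_comp_2d (fun u v => Im (h (u, v)))
             (fun s => r * cos s) (fun s => r * sin s)); auto;
      apply is_derive_Reals; auto_derive; auto; ring.
Qed.

Lemma continuity_2d_pt_circ (f : C -> C) (r t : R) :
  ccont f (circ r t) ->
  continuity_2d_pt (fun u v => Re (f (circ u v))) r t /\
  continuity_2d_pt (fun u v => Im (f (circ u v))) r t.
Proof.
  intros H.
  assert (key : forall eps : posreal, locally_2d (fun u v =>
    Cmod (f (circ u v) - f (circ r t))%C < eps) r t).
  { intros eps. destruct (proj1 (ccont_iff f (circ r t)) H eps) as [d Hd].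
    assert (Hd2 : 0 < d / 2) by (assert (T := cond_pos d); lra).
    assert (C1 : continuity_2d_pt (fun u v => u * cos v) r t).
    { apply continuity_2d_pt_mult; [apply continuity_2d_pt_id1 |].
      apply (continuity_1d_2d_pt_comp cos); [apply continuity_cos | apply continuity_2d_pt_id2]. }
    assert (C2 : continuity_2d_pt (fun u v => u * sin v) r t).
    { apply continuity_2d_pt_mult; [apply continuity_2d_pt_id1 |].
      apply (continuity_1d_2d_pt_comp sin); [apply continuity_sin | apply continuity_2d_pt_id2]. }
    generalize (locally_2d_and _ _ _ _ (C1 (mkposreal _ Hd2)) (C2 (mkposreal _ Hd2))).
    apply locally_2d_impl, locally_2d_forall. simpl. intros u v [Hu Hv].
    apply Hd. eapply Rle_lt_trans;
      [apply (Cmod_le_Rabs (u * cos v - r * cos t) (u * sin v - r * sin t)) | lra]. }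
  split; intros eps; generalize (key eps); apply locally_2d_impl, locally_2d_forall;
    intros u v Huv; (eapply Rle_lt_trans; [| exact Huv]).
  - apply (re_le_Cmod (f (circ u v) - f (circ r t))%C).
  - apply (im_le_Cmod (f (circ u v) - f (circ r t))%C).
Qed.

Lemma continuity_2d_pt_continuous (F : R -> R -> R) (r t : R) :
  continuity_2d_pt F r t -> continuous (F r) t.
Proof.
  intros H. apply continuity_pt_filterlim. intros eps He.
  destruct (H (mkposreal _ He)) as [d Hd]. exists d. split; [apply cond_pos |].
  intros s [_ Hs]. apply Hd; [| exact Hs].
  unfold Rminus. rewrite Rplus_opp_r, Rabs_R0. apply cond_pos.
Qed.

Lemma continuous_circ (f : C -> C) (r t : R) :
  ccont f (circ r t) ->
  continuous (fun s => Re (f (circ r s))) t /\ continuous (fun s => Im (f (circ r s))) t.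
Proof.
  intros H. apply continuity_2d_pt_circ in H. destruct H as [H1 H2].
  split; [apply (continuity_2d_pt_continuous (fun u v => Re (f (circ u v)))) |
          apply (continuity_2d_pt_continuous (fun u v => Im (f (circ u v))))]; assumption.
Qed.

Lemma continuous_circ_Cmod2 (f : C -> C) (r t : R) :
  ccont f (circ r t) -> continuous (fun s => Cmod (f (circ r s)) ^ 2) t.
Proof.
  intros H. apply continuous_circ in H. destruct H as [H1 H2].
  apply continuous_ext with
    (fun s => Re (f (circ r s)) * Re (f (circ r s)) + Im (f (circ r s)) * Im (f (circ r s))).
  { intros s. rewrite Cmod2_alt. match goal with |- ?x = ?y => change (@eq R x y) end. ring. }
  apply (@continuous_plus R_UniformSpace R_AbsRing R_NormedModule);
    apply (@continuous_mult R_UniformSpace R_AbsRing); assumption.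
Qed.

(** The circle lemmas stay away from 0 because the cross term in [rogosinski] contains [1/z]. *)
Definition punctured_disc (z : C) : Prop := 0 < Cmod z < 1.

Lemma hol_cont (D : C -> Prop) (h : C -> C) (z : C) : hol D h -> D z -> ccont h z.
Proof. intros [h' H] Hz. apply cderiv_cont with (h' z). now apply H. Qed.

Lemma punctured_circ (r t : R) : 0 < r < 1 -> punctured_disc (circ r t).
Proof. intros Hr. unfold punctured_disc. rewrite Cmod_circ; lra. Qed.

Lemma ex_RInt_circ_Re (h : C -> C) (r : R) :
  hol punctured_disc h -> 0 < r < 1 -> ex_RInt (fun t => Re (h (circ r t))) 0 (2 * PI).
Proof.
  intros Hh Hr. apply (@ex_RInt_continuous R_CompleteNormedModule).
  intros t _. apply continuous_circ. apply hol_cont with (1 := Hh). now apply punctured_circ.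
Qed.

Lemma ex_RInt_circ_Cmod2 (h : C -> C) (r : R) :
  hol punctured_disc h -> 0 < r < 1 -> ex_RInt (fun t => Cmod (h (circ r t)) ^ 2) 0 (2 * PI).
Proof.
  intros Hh Hr. apply (@ex_RInt_continuous R_CompleteNormedModule).
  intros t _. apply continuous_circ_Cmod2. apply hol_cont with (1 := Hh).
  now apply punctured_circ.
Qed.

(* By the Cauchy-Riemann equations [d/dr Re h(r e^it) = (1/r) d/dt Im h(r e^it)],
   whose integral over a period vanishes. *)
Lemma is_derive_circle_mean (h : C -> C) (r : R) :
  hol punctured_disc h -> 0 < r < 1 ->
  is_derive (fun u => RInt (fun t => Re (h (circ u t))) 0 (2 * PI)) r 0.
Proof.
  intros Hh Hr. assert (Hh0 := Hh). destruct Hh as [h' Hh].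
  set (D := fun u t => Re (h' (circ u t) * (cos t, sin t))%C).
  assert (Hloc : locally r (fun u => 0 < u < 1)).
  { apply (open_and _ _ (open_gt 0) (open_lt 1)). lra. }
  assert (HD : forall u t, 0 < u < 1 -> is_derive (fun x => Re (h (circ x t))) u (D u t)).
  { intros u t Hu. apply is_derive_circ, Hh. now apply punctured_circ. }
  assert (HC : forall t, continuity_2d_pt D r t).
  { intros t. destruct (continuity_2d_pt_circ h' r t) as [C1 C2].
    { apply Hh. now apply punctured_circ. }
    apply continuity_2d_pt_ext with
      (fun u v => Re (h' (circ u v)) * cos v - Im (h' (circ u v)) * sin v).
    { intros u v. unfold D, Re, Im, Cmult. simpl. reflexivity. }
    apply continuity_2d_pt_minus; apply continuity_2d_pt_mult; auto.
    - apply (continuity_1d_2d_pt_comp cos); [apply continuity_cos | apply continuity_2d_pt_id2].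
    - apply (continuity_1d_2d_pt_comp sin); [apply continuity_sin | apply continuity_2d_pt_id2]. }
  assert (E : RInt (fun t => Derive (fun u => Re (h (circ u t))) r) 0 (2 * PI) = 0).
  { rewrite (RInt_ext _ (fun t => D r t)).
    2:{ intros t _. apply is_derive_unique. now apply HD. }
    assert (I : is_RInt (fun t => r * D r t) 0 (2 * PI)
                  (minus (Im (h (circ r (2 * PI)))) (Im (h (circ r 0))))).
    { apply (is_RInt_derive (fun t => Im (h (circ r t)))).
      - intros t _. apply is_derive_circ, Hh. now apply punctured_circ.
      - intros t _. apply (continuous_scal_r (V := R_NormedModule) r (D r)).
        apply continuity_2d_pt_continuous, HC. }
    replace (circ r (2 * PI)) with (circ r 0) in I
      by (unfold circ; now rewrite cos_2PI, sin_2PI, cos_0, sin_0).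
    apply (is_RInt_unique (V := R_CompleteNormedModule)) in I. rewrite minus_eq_zero in I.
    assert (I2 := RInt_scal (V := R_CompleteNormedModule) (D r) 0 (2 * PI) r).
    unfold scal in I2; simpl in I2; unfold mult in I2; simpl in I2.
    rewrite I in I2. apply Rmult_eq_reg_l with r; [| lra].
    rewrite Rmult_0_r. symmetry. apply I2.
    apply (@ex_RInt_continuous R_CompleteNormedModule). intros t _.
    apply continuity_2d_pt_continuous, HC. }
  assert (G : is_derive (fun u => RInt (fun t => Re (h (circ u t))) 0 (2 * PI)) r
                (RInt (fun t => Derive (fun u => Re (h (circ u t))) r) 0 (2 * PI)));
    [| now rewrite E in G].
  apply is_derive_RInt_param.
  - revert Hloc. apply filter_imp. intros u Hu t _. eexists. now apply HD.
  - intros t _. apply continuity_2d_pt_ext_loc with D; [| apply HC].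
    destruct Hloc as [d Hd]. exists d. intros u v Hu _. symmetry.
    apply is_derive_unique, HD, Hd. exact Hu.
  - revert Hloc. apply filter_imp. intros u Hu. now apply ex_RInt_circ_Re.
Qed.

(** The point 0 itself is excluded: the function may be given there by a formula with [1/z], and
    only its limit counts. *)
Definition vanishes_at_0 (h : C -> C) : Prop :=
  forall eps : posreal, exists d : posreal,
    forall z, 0 < Cmod z < d -> Cmod (h z) <= eps.

(** The integral does not depend on the radius, and it tends to 0 as the circle shrinks to the
    origin. *)
Lemma circle_mean_0 (h : C -> C) (r : R) :
  hol punctured_disc h -> vanishes_at_0 h -> 0 < r < 1 ->
  RInt (fun t => Re (h (circ r t))) 0 (2 * PI) = 0.
Proof.
  intros Hh H0 Hr. set (U := fun u => RInt (fun t => Re (h (circ u t))) 0 (2 * PI)).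
  change (U r = 0).
  assert (Hc : forall s, 0 < s < r -> U s = U r).
  { intros s Hs. destruct (MVT_gen U s r (fun _ => 0)) as [c [_ Hc]].
    - intros x Hx. rewrite Rmin_left, Rmax_right in Hx by lra.
      apply is_derive_circle_mean; auto. lra.
    - intros x Hx. rewrite Rmin_left, Rmax_right in Hx by lra.
      apply continuity_pt_filterlim.
      apply (@ex_derive_continuous R_AbsRing R_NormedModule U). exists 0.
      apply is_derive_circle_mean; auto. lra.
    - lra. }
  assert (HPI := PI_RGT_0).
  apply Rabs_eq_0, Rle_antisym; [| apply Rabs_pos].
  apply le_epsilon. intros e He. rewrite Rplus_0_l.
  assert (He2 : 0 < e / (2 * PI)) by (apply Rdiv_lt_0_compat; lra).
  destruct (H0 (mkposreal _ He2)) as [d Hd]. simpl in Hd. assert (Hd0 := cond_pos d).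
  set (s := Rmin d r / 2).
  assert (Hs : 0 < s < r /\ s < d).
  { assert (0 < Rmin d r) by (apply Rmin_pos; lra).
    assert (M1 := Rmin_l d r). assert (M2 := Rmin_r d r). unfold s. lra. }
  rewrite <- (Hc s) by lra.
  replace e with ((2 * PI - 0) * (e / (2 * PI))) by (field; lra).
  apply abs_RInt_le_const; [lra | apply ex_RInt_circ_Re; auto; lra |].
  intros t _. eapply Rle_trans; [apply re_le_Cmod |]. apply Hd. rewrite Cmod_circ; lra.
Qed.

Lemma punctured_in_disc (z : C) : punctured_disc z -> in_disc z.
Proof. now intros [_ H]. Qed.

Lemma hol_pol (D : C -> Prop) (g : C -> C) (n : nat) : forall a : nat -> C,
  hol D g -> hol D (fun z => pol n a (g z)).
Proof.
  induction n as [|n IH]; intros a Hg; simpl.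
  - apply hol_const.
  - apply hol_plus; [apply hol_const |]. apply hol_mult; auto.
Qed.

Lemma Cmod2_plus (x y : C) :
  Cmod (x + y)%C ^ 2 = Cmod x ^ 2 + Cmod y ^ 2 + 2 * Re (Cconj x * y)%C.
Proof.
  rewrite !Cmod2_alt. destruct x, y. unfold Re, Im, Cconj, Cmult, Cplus. simpl. ring.
Qed.

Lemma vanishes_at_0_of_cont (h : C -> C) : ccont h 0%C -> h 0%C = 0%C -> vanishes_at_0 h.
Proof.
  intros H E eps. destruct (proj1 (ccont_iff h 0%C) H eps) as [d Hd].
  exists d. intros z Hz. specialize (Hd z). rewrite E in Hd.
  replace (z - 0)%C with z in Hd by ring. replace (h z - 0)%C with (h z) in Hd by ring.
  apply Rlt_le, Hd. apply Hz.
Qed.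

(** The cross term is twice the real part of [Cconj c * f], which is holomorphic and vanishes at 0,
    so its mean is 0. This is one step of Parseval's identity. *)
Lemma RInt_circ_expand (f : C -> C) (c : C) (r : R) :
  hol in_disc f -> f 0%C = 0%C -> 0 < r < 1 ->
  RInt (fun t => Cmod (c + f (circ r t))%C ^ 2) 0 (2 * PI)
    = 2 * PI * Cmod c ^ 2 + RInt (fun t => Cmod (f (circ r t)) ^ 2) 0 (2 * PI).
Proof.
  intros Hf H0 Hr.
  assert (Hp : hol punctured_disc f) by (revert Hf; apply hol_sub, punctured_in_disc).
  set (h := fun z => (Cconj c * f z)%C).
  assert (Hh : hol in_disc h) by (apply hol_mult; [apply hol_const | auto]).
  assert (Hhp : hol punctured_disc h) by (revert Hh; apply hol_sub, punctured_in_disc).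
  assert (M : RInt (fun t => Re (h (circ r t))) 0 (2 * PI) = 0).
  { apply circle_mean_0; auto. apply vanishes_at_0_of_cont.
    - apply hol_cont with (1 := Hh). unfold in_disc. rewrite Cmod_0. lra.
    - unfold h. rewrite H0. ring. }
  assert (E1 := ex_RInt_circ_Cmod2 f r Hp Hr). assert (E2 := ex_RInt_circ_Re h r Hhp Hr).
  apply is_RInt_unique.
  assert (I := is_RInt_plus _ _ _ _ _ _
     (is_RInt_plus _ _ _ _ _ _ (is_RInt_const 0 (2 * PI) (Cmod c ^ 2))
                             (RInt_correct (V := R_CompleteNormedModule) _ _ _ E1))
     (is_RInt_scal _ _ _ 2 _ (RInt_correct (V := R_CompleteNormedModule) _ _ _ E2))).
  rewrite M in I.
  match type of I with is_RInt _ _ _ ?v =>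
    replace v with (2 * PI * Cmod c ^ 2 + RInt (fun t => Cmod (f (circ r t)) ^ 2) 0 (2 * PI)) in I
  end.
  2:{ unfold plus, scal; simpl. unfold mult; simpl. ring. }
  revert I. apply is_RInt_ext. intros t _. rewrite Cmod2_plus. reflexivity.
Qed.

(** * Rogosinski's inequality *)

Lemma sum_f_R0_S (u : nat -> R) (n : nat) :
  sum_f_R0 u (S n) = u O + sum_f_R0 (fun k => u (S k)) n.
Proof. rewrite decomp_sum by lia. reflexivity. Qed.

(* Littlewood's argument: [w (b_1 + b_2 w + ...)] has mean [0], hence is orthogonal to the
   constant [b_0], and [|w| < 1] lets one drop the factor [w] and iterate. *)
Lemma RInt_pol_subordinate_le (w : C -> C) (r : R) (n : nat) :
  hol in_disc w -> w 0%C = 0%C -> (forall z, in_disc z -> in_disc (w z)) -> 0 < r < 1 ->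
  forall b : nat -> C,
  RInt (fun t => Cmod (pol n b (w (circ r t))) ^ 2) 0 (2 * PI)
    <= 2 * PI * sum_f_R0 (fun k => Cmod (b k) ^ 2) n.
Proof.
  intros Hw H0 Hd Hr. assert (HPI := PI_RGT_0).
  induction n as [|n IH]; intros b.
  - simpl pol. rewrite RInt_const. unfold scal; simpl. unfold mult; simpl. lra.
  - simpl pol. rewrite (RInt_circ_expand (fun z => w z * pol n (fun k => b (S k)) (w z))%C).
    + rewrite sum_f_R0_S, Rmult_plus_distr_l. apply Rplus_le_compat_l.
      eapply Rle_trans; [| apply (IH (fun k => b (S k)))].
      assert (Hp : hol punctured_disc w) by (revert Hw; apply hol_sub, punctured_in_disc).
      assert (Hq : hol punctured_disc (fun z => pol n (fun k => b (S k)) (w z)))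
        by now apply hol_pol.
      apply RInt_le; [lra | | |].
      * apply (ex_RInt_circ_Cmod2 (fun z => w z * pol n (fun k => b (S k)) (w z))%C); auto.
        now apply hol_mult.
      * now apply (ex_RInt_circ_Cmod2 (fun z => pol n (fun k => b (S k)) (w z))).
      * intros t _. rewrite Cmod_mult, Rpow_mult_distr.
        rewrite <- (Rmult_1_l (Cmod (pol _ _ _) ^ 2)) at 2.
        apply Rmult_le_compat_r; [apply pow2_ge_0 |].
        rewrite <- (pow1 2). apply pow_incr. split; [apply Cmod_ge_0 |].
        apply Rlt_le, Hd. unfold in_disc. rewrite Cmod_circ; lra.
    + apply hol_mult; auto. now apply hol_pol.
    + rewrite H0. ring.
    + auto.
Qed.

(** Parseval's identity for polynomials, by the same peeling as for [w]; now the dropped factor has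
    modulus exactly [r], so equality survives. *)
Lemma RInt_pol_circ (r : R) (n : nat) : 0 < r < 1 ->
  forall a : nat -> C,
  RInt (fun t => Cmod (pol n a (circ r t)) ^ 2) 0 (2 * PI)
    = 2 * PI * sum_f_R0 (fun k => Cmod (a k) ^ 2 * (r ^ 2) ^ k) n.
Proof.
  intros Hr. induction n as [|n IH]; intros a.
  - simpl pol. rewrite RInt_const. unfold scal; simpl. unfold mult; simpl. ring.
  - simpl pol. rewrite (RInt_circ_expand (fun z => z * pol n (fun k => a (S k)) z)%C).
    + rewrite sum_f_R0_S, Rmult_plus_distr_l. f_equal; [simpl; ring |].
      rewrite (RInt_ext _ (fun t => scal (r ^ 2) (Cmod (pol n (fun k => a (S k)) (circ r t)) ^ 2))).
      2:{ intros t _. rewrite Cmod_mult, Rpow_mult_distr, Cmod_circ by lra. reflexivity. }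
      rewrite (RInt_scal (V := R_CompleteNormedModule)).
      2:{ apply (ex_RInt_circ_Cmod2 (fun z => pol n (fun k => a (S k)) z)); auto.
          apply hol_pol, hol_id. }
      rewrite IH. unfold scal; simpl. unfold mult; simpl.
      rewrite <- Rmult_assoc, (Rmult_comm _ (2 * PI)), Rmult_assoc. f_equal.
      rewrite scal_sum. apply sum_eq. intros i _. ring.
    + apply hol_mult; [apply hol_id | apply hol_pol, hol_id].
    + ring.
    + auto.
Qed.

Lemma Cconj_pol (n : nat) : forall (a : nat -> C) (z : C),
  Cconj (pol n a z) = pol n (fun k => Cconj (a k)) (Cconj z).
Proof.
  induction n as [|n IH]; intros a z; simpl; [reflexivity |].
  now rewrite Cplus_conj, Cmult_conj, IH.
Qed.

(** Meant for the conjugated polynomial at [r^2 / z], whose modulus is at least 1 for small [z]: it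
    has a pole of order at most [n] at the origin. *)
Lemma pol_growth (n : nat) : forall a : nat -> C,
  exists M, 0 <= M /\ forall z, 1 <= Cmod z -> Cmod (pol n a z) <= M * Cmod z ^ n.
Proof.
  induction n as [|n IH]; intros a.
  - exists (Cmod (a O)). split; [apply Cmod_ge_0 |]. intros z _. simpl. lra.
  - destruct (IH (fun k => a (S k))) as [M [HM H]]. exists (Cmod (a O) + M).
    assert (Ha := Cmod_ge_0 (a O)). split; [lra |].
    intros z Hz. simpl pol. eapply Rle_trans; [apply Cmod_triangle |].
    rewrite Cmod_mult. specialize (H z Hz).
    assert (1 <= Cmod z ^ S n) by now apply pow_R1_Rle.
    assert (Cmod z * Cmod (pol n (fun k => a (S k)) z) <= Cmod z * (M * Cmod z ^ n))
      by (apply Rmult_le_compat_l; lra).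
    replace ((Cmod (a O) + M) * Cmod z ^ S n)
      with (Cmod (a O) * Cmod z ^ S n + Cmod z * (M * Cmod z ^ n)) by (simpl; ring).
    apply Rplus_le_compat; auto. rewrite <- (Rmult_1_r (Cmod (a O))) at 1.
    now apply Rmult_le_compat_l.
Qed.

Lemma pow_1_minus_ge (x : R) (n : nat) : 0 <= x <= 1 -> 1 - INR n * x <= (1 - x) ^ n.
Proof.
  intros Hx. induction n as [|n IH]; [simpl; lra |]. rewrite S_INR. simpl.
  assert (Hn := pos_INR n).
  apply Rle_trans with ((1 - x) * (1 - INR n * x)).
  - assert (0 <= INR n * (x * x)) by (apply Rmult_le_pos; nra). lra.
  - apply Rmult_le_compat_l; lra.
Qed.

(** Since the full series agree, the difference is that of the two tails; the tail of [b] at [w z]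
    is also [O(z^(n+1))] because [w z = O(z)]. *)
Lemma subordinate_tail_bound (a b : nat -> C) (w : C -> C) (n : nat) :
  absconv a -> absconv b ->
  hol in_disc w -> w 0%C = 0%C ->
  (forall z, in_disc z -> psum a z = psum b (w z)) ->
  exists K, exists d : posreal, 0 <= K /\ forall z, Cmod z < d ->
    Cmod (pol n b (w z) - pol n a z)%C <= K * Cmod z ^ S n.
Proof.
  intros Ha Hb [w' Hw] H0 Hab.
  destruct (psum_pol_bound n a Ha) as [Ka [HKa Ba]].
  destruct (psum_pol_bound n b Hb) as [Kb [HKb Bb]].
  assert (Hw0 : cderiv w 0%C (w' 0%C)).
  { apply Hw. unfold in_disc. rewrite Cmod_0. lra. }
  destruct (proj1 (cderiv_iff _ _ _) Hw0 (mkposreal 1 Rlt_0_1)) as [d0 Hd0]. simpl in Hd0.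
  (* Differentiability of [w] at 0 with error 1 gives [|w z| <= L |z|]; the radius chosen below
     keeps [w z] in the disc of radius [1 / 2], where the tail bound holds. *)
  set (L := 1 + Cmod (w' 0%C)). assert (HL : 1 <= L) by (unfold L; assert (T := Cmod_ge_0 (w' 0%C)); lra).
  assert (HwL : forall z, Cmod z < d0 -> Cmod (w z) <= L * Cmod z).
  { intros z Hz. specialize (Hd0 z). rewrite H0 in Hd0.
    replace (z - 0)%C with z in Hd0 by ring. specialize (Hd0 Hz).
    assert (T := Cmod_triangle (w z - 0 - z * w' 0)%C (z * w' 0)%C).
    replace (w z - 0 - z * w' 0 + z * w' 0)%C with (w z) in T by ring.
    rewrite (Cmod_mult z) in T. unfold L. lra. }
  assert (Hd : 0 < Rmin d0 (1 / 2 / L)).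
  { apply Rmin_pos; [apply cond_pos |]. apply Rdiv_lt_0_compat; lra. }
  exists (Kb * L ^ S n + Ka), (mkposreal _ Hd). split.
  { assert (0 <= Kb * L ^ S n) by (apply Rmult_le_pos; auto; apply pow_le; lra). lra. }
  simpl pos. intros z Hz. apply Rmin_Rgt_l in Hz. destruct Hz as [Hz1 Hz2].
  assert (Hz3 : L * Cmod z <= 1 / 2).
  { apply Rle_trans with (L * (1 / 2 / L)); [apply Rmult_le_compat_l; lra |].
    right. field. lra. }
  assert (Hz4 : Cmod z <= 1 / 2) by (assert (T := Cmod_ge_0 z); nra).
  specialize (HwL z Hz1).
  replace (pol n b (w z) - pol n a z)%C
    with (- (psum b (w z) - pol n b (w z)) + (psum a z - pol n a z))%C
    by (rewrite Hab by (unfold in_disc; lra); ring).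
  eapply Rle_trans; [apply Cmod_triangle |]. rewrite Cmod_opp, Rmult_plus_distr_r.
  apply Rplus_le_compat; [| now apply Ba].
  eapply Rle_trans; [apply Bb; lra |]. rewrite Rmult_assoc. apply Rmult_le_compat_l; auto.
  rewrite <- Rpow_mult_distr. apply pow_incr. split; [apply Cmod_ge_0 | auto].
Qed.

(** With [P = pol n a] and [pol n b (w z) = P + E] on a circle, the cross term has mean 0. Expanding
    [|P + E|^2] and dropping [|E|^2] bounds the mean of [|P|^2] by that of [|pol n b (w z)|^2],
    hence by Littlewood's argument; then [r] tends to 1. *)
Lemma rogosinski (a b : nat -> C) (w : C -> C) (n : nat) :
  absconv a -> absconv b ->
  hol in_disc w -> w 0%C = 0%C -> (forall z, in_disc z -> in_disc (w z)) ->
  (forall z, in_disc z -> psum a z = psum b (w z)) ->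
  sum_f_R0 (fun k => Cmod (a k) ^ 2) n <= sum_f_R0 (fun k => Cmod (b k) ^ 2) n.
Proof.
  intros Ha Hb Hw H0 Hd Hab. assert (HPI := PI_RGT_0).
  set (E := fun z => (pol n b (w z) + - (1) * pol n a z)%C).
  assert (HE : hol in_disc E).
  { apply hol_plus; [now apply hol_pol |].
    apply hol_mult; [apply hol_const | apply hol_pol, hol_id]. }
  destruct (subordinate_tail_bound a b w n Ha Hb Hw H0 Hab) as [K [d [HK BE]]].
  assert (key : forall r, 0 < r < 1 ->
    sum_f_R0 (fun k => Cmod (a k) ^ 2 * (r ^ 2) ^ k) n <= sum_f_R0 (fun k => Cmod (b k) ^ 2) n).
  { intros r Hr. apply Rmult_le_reg_l with (2 * PI); [lra |].
    rewrite <- RInt_pol_circ by auto.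
    apply Rle_trans with (2 := RInt_pol_subordinate_le w r n Hw H0 Hd Hr b).
    (* On [|z| = r] the conjugate of [z] is [r^2 / z]; hence the cross term is the real
       part of a function analytic off [0], which vanishes at [0] because [E = O(z^(n+1))]. *)
    set (h := fun z => (pol n (fun k => Cconj (a k)) (RtoC (r ^ 2) * / z) * E z)%C).
    assert (Hh : hol punctured_disc h).
    { apply hol_mult; [| revert HE; apply hol_sub, punctured_in_disc].
      apply hol_pol, hol_mult; [apply hol_const |]. apply hol_Cinv.
      intros z [Hz _]. now apply Cmod_gt_0. }
    assert (Hr2 : 0 < r ^ 2) by (apply pow_lt; lra).
    assert (Mh : RInt (fun t => Re (h (circ r t))) 0 (2 * PI) = 0).
    { apply circle_mean_0; auto. intros eps.
      destruct (pol_growth n (fun k => Cconj (a k))) as [M [HM G]].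
      set (Q := M * (r ^ 2) ^ n * K).
      assert (HQ : 0 <= Q) by (unfold Q; repeat apply Rmult_le_pos; auto; apply pow_le; lra).
      assert (He := cond_pos eps).
      assert (Hm : 0 < Rmin (Rmin d (r ^ 2)) (eps / (Q + 1))).
      { repeat apply Rmin_pos; auto; [apply cond_pos | apply Rdiv_lt_0_compat; lra]. }
      exists (mkposreal _ Hm). simpl pos. intros z [Hz0 Hz].
      apply Rmin_Rgt_l in Hz. destruct Hz as [Hz Hz3].
      apply Rmin_Rgt_l in Hz. destruct Hz as [Hz1 Hz2].
      assert (Hzn : z <> 0%C) by now apply Cmod_gt_0.
      assert (Hmz : Cmod (RtoC (r ^ 2) * / z)%C = r ^ 2 / Cmod z).
      { rewrite Cmod_mult, Cmod_inv, Cmod_R, Rabs_pos_eq; auto. lra. }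
      assert (G1 : 1 <= r ^ 2 / Cmod z).
      { apply Rmult_le_reg_r with (Cmod z); auto. field_simplify; lra. }
      unfold h. rewrite Cmod_mult.
      (* The factor [Cmod z ^ S n] cancels the pole of order [n] and leaves one power of
         [Cmod z]. *)
      apply Rle_trans with ((M * (r ^ 2 / Cmod z) ^ n) * (K * Cmod z ^ S n)).
      - apply Rmult_le_compat; try apply Cmod_ge_0.
        + rewrite <- Hmz. apply G. now rewrite Hmz.
        + replace (E z) with (pol n b (w z) - pol n a z)%C by (unfold E; ring). now apply BE.
      - replace ((M * (r ^ 2 / Cmod z) ^ n) * (K * Cmod z ^ S n)) with (Q * Cmod z).
        + assert ((Q + 1) * Cmod z <= eps); [| lra].
          apply Rle_trans with ((Q + 1) * (eps / (Q + 1))); [apply Rmult_le_compat_l; lra |].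
          right. field. lra.
        + unfold Q, Rdiv. rewrite Rpow_mult_distr, pow_inv. simpl pow. field.
          apply pow_nonzero. lra. }
    assert (Hp1 : hol punctured_disc (fun z => pol n a z)) by apply hol_pol, hol_id.
    assert (Hp2 : hol punctured_disc (fun z => pol n b (w z))).
    { apply hol_pol. revert Hw. apply hol_sub, punctured_in_disc. }
    assert (X1 := ex_RInt_circ_Cmod2 _ r Hp1 Hr). assert (X2 := ex_RInt_circ_Re h r Hh Hr).
    assert (X3 := ex_RInt_circ_Cmod2 _ r Hp2 Hr).
    assert (I := is_RInt_plus _ _ _ _ _ _ (RInt_correct (V := R_CompleteNormedModule) _ _ _ X1)
       (is_RInt_scal _ _ _ 2 _ (RInt_correct (V := R_CompleteNormedModule) _ _ _ X2))).
    rewrite Mh in I. unfold plus, scal in I; simpl in I. unfold mult in I; simpl in I.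
    rewrite Rmult_0_r, Rplus_0_r in I.
    apply (is_RInt_le _ _ 0 (2 * PI) _ _ ltac:(lra) I
             (RInt_correct (V := R_CompleteNormedModule) _ _ _ X3)).
    intros t _.
    replace (pol n b (w (circ r t))) with (pol n a (circ r t) + E (circ r t))%C
      by (unfold E; ring).
    assert (Cc : Cconj (circ r t) = (RtoC (r ^ 2) * / circ r t)%C).
    { assert (Hz : circ r t <> 0%C) by (apply Cmod_gt_0; rewrite Cmod_circ; lra).
      replace (RtoC (r ^ 2)) with (circ r t * Cconj (circ r t))%C; [now field |].
      rewrite <- Cmod2_conj, Cmod_circ; [reflexivity | lra]. }
    assert (T := Cmod2_plus (pol n a (circ r t)) (E (circ r t))).
    rewrite Cconj_pol, Cc in T. fold (h (circ r t)) in T.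
    assert (P := pow2_ge_0 (Cmod (E (circ r t)))). simpl in *. lra. }
  set (A := sum_f_R0 (fun k => Cmod (a k) ^ 2) n) in *.
  set (B := sum_f_R0 (fun k => Cmod (b k) ^ 2) n) in *.
  assert (HA : 0 <= A) by (apply cond_pos_sum; intros k; apply pow2_ge_0).
  apply le_epsilon. intros e He.
  (* For [r = 1 - x], Bernoulli's inequality gives [r^(2k) >= 1 - N x] for all [k <= n], so [key]
     yields [A (1 - N x) <= B]; [x] is chosen to make [N A x <= e]. *)
  set (N := INR (2 * n)). assert (HN : 0 <= N) by apply pos_INR.
  assert (HNA : 0 <= N * A) by now apply Rmult_le_pos.
  set (x := Rmin (1 / 2) (e / (N * A + 1))).
  assert (Hx : 0 < x <= 1 / 2).
  { split; [apply Rmin_pos; [lra | apply Rdiv_lt_0_compat; lra] | apply Rmin_l]. }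
  assert (Hx2 : (N * A + 1) * x <= e).
  { apply Rle_trans with ((N * A + 1) * (e / (N * A + 1))).
    - apply Rmult_le_compat_l; [lra | apply Rmin_r].
    - right. field. lra. }
  specialize (key (1 - x) ltac:(lra)).
  assert (L : A * (1 - N * x) <= sum_f_R0 (fun k => Cmod (a k) ^ 2 * ((1 - x) ^ 2) ^ k) n).
  { unfold A. rewrite Rmult_comm, scal_sum. apply sum_Rle. intros k Hk.
    apply Rmult_le_compat_l; [apply pow2_ge_0 |]. rewrite <- pow_mult.
    eapply Rle_trans; [apply pow_1_minus_ge with (n := (2 * n)%nat); lra |].
    replace (2 * n)%nat with (2 * k + (2 * n - 2 * k))%nat by lia. rewrite pow_add.
    rewrite <- (Rmult_1_r ((1 - x) ^ (2 * k))) at 2.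
    apply Rmult_le_compat_l; [apply pow_le; lra |].
    eapply Rle_trans; [apply pow_incr with (y := 1); lra | rewrite pow1; lra]. }
  nra.
Qed.

(** * The Basel sum and the dilogarithm bound *)

Lemma sum_f_R0_rev (f : nat -> R) (n : nat) :
  sum_f_R0 f n = sum_f_R0 (fun k => f (n - k)%nat) n.
Proof.
  induction n as [|n IH]; [reflexivity |].
  rewrite (sum_f_R0_S (fun k => f (S n - k)%nat)), Nat.sub_0_r. simpl. rewrite IH. lra.
Qed.

(** From [sin x = 2 sin (x/2) cos (x/2)] and [sin^2 + cos^2 = 1]. The cosine is written as the sine
    of the complementary angle, so that both terms have the same form again. *)
Lemma inv_sin2_half (x : R) : 0 < x < PI ->
  / sin x ^ 2 = / 4 * (/ sin (x / 2) ^ 2 + / sin ((PI - x) / 2) ^ 2).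
Proof.
  intros Hx. assert (HPI := PI_RGT_0).
  replace ((PI - x) / 2) with (PI / 2 - x / 2) by field. rewrite sin_shift.
  replace x with (2 * (x / 2)) at 1 by field. rewrite sin_2a.
  assert (Hs : 0 < sin (x / 2)) by (apply sin_gt_0; lra).
  assert (Hc : 0 < cos (x / 2)) by (apply cos_gt_0; lra).
  assert (E := sin2_cos2 (x / 2)). unfold Rsqr in E.
  set (s := sin (x / 2)) in *. set (c := cos (x / 2)) in *.
  field_simplify_eq; [| lra]. rewrite <- (Rmult_1_l 4), <- E at 1. ring.
Qed.

(** With the exponent [m + 2], exactly [2 ^ m] of these angles lie below [PI / 2]. *)
Definition odd_angle (m k : nat) : R := INR (2 * k + 1) * PI / 2 ^ (m + 2).

Lemma odd_angle_bound (m k : nat) : (k <= 2 ^ m - 1)%nat -> 0 < odd_angle m k < PI / 2.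
Proof.
  intros Hk. assert (HPI := PI_RGT_0).
  assert (H2 : 0 < 2 ^ (m + 2)) by (apply pow_lt; lra).
  assert (H1 : (1 <= 2 ^ m)%nat) by (apply Nat.neq_0_lt_0, Nat.pow_nonzero; lia).
  unfold odd_angle. split.
  - apply Rdiv_lt_0_compat; auto. apply Rmult_lt_0_compat; auto. apply lt_0_INR. lia.
  - apply Rmult_lt_reg_r with (1 := H2).
    replace (INR (2 * k + 1) * PI / 2 ^ (m + 2) * 2 ^ (m + 2)) with (PI * INR (2 * k + 1))
      by (field; lra).
    replace (PI / 2 * 2 ^ (m + 2)) with (PI * (2 ^ m * 2)) by (rewrite pow_add; simpl; field).
    apply Rmult_lt_compat_l; auto.
    replace (2 ^ m * 2) with (INR (2 ^ m * 2)).
    + apply lt_INR. lia.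
    + rewrite mult_INR, pow_INR. reflexivity.
Qed.

(* [1/sin^2 x = (1/sin^2 (x/2) + 1/sin^2 ((PI - x)/2)) / 4] maps the odd multiples of
   [PI / 2^(m+2)] in [(0, PI/2)] to those of [PI / 2^(m+3)]. *)
Lemma sum_inv_sin2_odd_angle (m : nat) :
  sum_f_R0 (fun k => / sin (odd_angle m k) ^ 2) (2 ^ m - 1) = 2 * 4 ^ m.
Proof.
  assert (HPI := PI_RGT_0). induction m as [|m IH].
  - change (/ sin (odd_angle 0 0) ^ 2 = 2 * 1). unfold odd_angle. replace (INR (2 * 0 + 1) * PI / 2 ^ (0 + 2)) with (PI / 4)
      by (simpl; field).
    rewrite sin_PI4. assert (H2 := sqrt_lt_R0 2 ltac:(lra)).
    replace ((1 / sqrt 2) ^ 2) with (/ (sqrt 2 * sqrt 2)) by (field; lra).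
    rewrite sqrt_sqrt by lra. field.
  - assert (H1 : (1 <= 2 ^ m)%nat) by (apply Nat.neq_0_lt_0, Nat.pow_nonzero; lia).
    replace (2 * 4 ^ S m) with (4 * (2 * 4 ^ m)) by (simpl; ring). rewrite <- IH.
    rewrite (tech2 _ (2 ^ m - 1)) by (simpl; lia).
    replace (2 ^ S m - 1 - S (2 ^ m - 1))%nat with (2 ^ m - 1)%nat by (simpl; lia).
    (* Reversing the upper half of the sum turns its [k]-th angle into [(PI - odd_angle m k) / 2],
       the partner of [odd_angle m k / 2]. *)
    rewrite (sum_f_R0_rev (fun i => / sin (odd_angle (S m) (S (2 ^ m - 1) + i)) ^ 2)).
    rewrite <- plus_sum, scal_sum. apply sum_eq. intros k Hk.
    assert (B := odd_angle_bound m k Hk).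
    rewrite (inv_sin2_half (odd_angle m k)) by lra.
    replace (odd_angle (S m) k) with (odd_angle m k / 2).
    2:{ unfold odd_angle. simpl. field. apply pow_nonzero. lra. }
    replace (odd_angle (S m) (S (2 ^ m - 1) + (2 ^ m - 1 - k))) with ((PI - odd_angle m k) / 2).
    2:{ unfold odd_angle.
        replace (2 * (S (2 ^ m - 1) + (2 ^ m - 1 - k)) + 1)%nat with (2 ^ m * 4 - (2 * k + 1))%nat
          by lia.
        rewrite (minus_INR (2 ^ m * 4)), mult_INR, pow_INR by lia.
        replace (INR 2) with 2 by reflexivity. replace (INR 4) with 4 by (simpl; ring).
        rewrite !pow_add. simpl. field. apply pow_nonzero. lra. }
    field. assert (Ha : 0 < sin (odd_angle m k / 2)) by (apply sin_gt_0; lra).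
    assert (Hb : 0 < sin ((PI - odd_angle m k) / 2)) by (apply sin_gt_0; lra). lra.
Qed.

(** From [sin x < x] and [x cos x <= sin x], the lower bound being [cot^2 x]. The second inequality
    is the mean value theorem for [sin t - t cos t], whose derivative is [t sin t]. *)
Lemma inv_sqr_sin_bounds (x : R) : 0 < x < PI / 2 ->
  / sin x ^ 2 - 1 <= / x ^ 2 <= / sin x ^ 2.
Proof.
  intros Hx. assert (HPI := PI_RGT_0).
  assert (Hs : 0 < sin x) by (apply sin_gt_0; lra).
  assert (Hc : 0 < cos x) by (apply cos_gt_0; lra).
  assert (Hsx : sin x < x) by (apply sin_lt_x; lra).
  assert (Htx : x * cos x <= sin x).
  { destruct (MVT_gen (fun t => sin t - t * cos t) 0 x (fun t => t * sin t)) as [c [Hc1 Hc2]].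
    - intros t _. auto_derive; auto. ring.
    - intros t _. apply continuity_pt_filterlim.
      apply (@ex_derive_continuous R_AbsRing R_NormedModule (fun t => sin t - t * cos t)).
      auto_derive. auto.
    - rewrite Rmin_left, Rmax_right in Hc1 by lra.
      rewrite sin_0 in Hc2.
      assert (0 <= sin c) by (apply sin_ge_0; lra).
      assert (0 <= c * sin c) by (apply Rmult_le_pos; lra).
      assert (0 <= c * sin c * (x - 0)) by (apply Rmult_le_pos; lra). lra. }
  split.
  - assert (E := sin2_cos2 x). unfold Rsqr in E.
    replace (/ sin x ^ 2 - 1) with ((cos x / sin x) ^ 2).
    + rewrite <- pow_inv. apply pow_incr. split.
      * apply Rlt_le, Rdiv_lt_0_compat; auto.
      * apply Rmult_le_reg_r with (x * sin x); [apply Rmult_lt_0_compat; lra |].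
        replace (cos x / sin x * (x * sin x)) with (x * cos x) by (field; lra).
        replace (/ x * (x * sin x)) with (sin x) by (field; lra). auto.
    + field_simplify_eq; [| lra]. simpl. lra.
  - apply Rinv_le_contravar; [apply pow_lt; auto |]. apply pow_incr. lra.
Qed.

(** Here [c] is the square of [PI / 2^(m+2)]. The sum over the angles differs from [2 * 4^m] by at
    most 1 per term, that is by at most [2^m], which is negligible after scaling. *)
Lemma sum_inv_odd_sqr_bounds (m : nat) :
  PI ^ 2 / 8 - PI ^ 2 / 16 * (/ 2) ^ m
    <= sum_f_R0 (fun k => / INR (2 * k + 1) ^ 2) (2 ^ m - 1) <= PI ^ 2 / 8.
Proof.
  assert (HPI := PI_RGT_0).
  assert (H1 : (1 <= 2 ^ m)%nat) by (apply Nat.neq_0_lt_0, Nat.pow_nonzero; lia).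
  assert (H4 : 0 < 4 ^ m) by (apply pow_lt; lra).
  assert (H2 : 0 < 2 ^ m) by (apply pow_lt; lra).
  assert (H42 : 4 ^ m = 2 ^ m * 2 ^ m) by (rewrite <- Rpow_mult_distr; f_equal; lra).
  set (c := PI ^ 2 / (16 * 4 ^ m)).
  assert (Hc : 0 < c) by (unfold c; apply Rdiv_lt_0_compat; [apply pow_lt |]; lra).
  assert (E : sum_f_R0 (fun k => / INR (2 * k + 1) ^ 2) (2 ^ m - 1)
              = c * sum_f_R0 (fun k => / odd_angle m k ^ 2) (2 ^ m - 1)).
  { rewrite scal_sum. apply sum_eq. intros k Hk. unfold odd_angle, c.
    assert (0 < INR (2 * k + 1)) by (apply lt_0_INR; lia).
    rewrite H42, pow_add. field. lra. }
  rewrite E.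
  assert (U : sum_f_R0 (fun k => / odd_angle m k ^ 2) (2 ^ m - 1) <= 2 * 4 ^ m).
  { rewrite <- sum_inv_sin2_odd_angle. apply sum_Rle. intros k Hk.
    apply inv_sqr_sin_bounds, odd_angle_bound, Hk. }
  assert (L : 2 * 4 ^ m - 2 ^ m <= sum_f_R0 (fun k => / odd_angle m k ^ 2) (2 ^ m - 1)).
  { rewrite <- sum_inv_sin2_odd_angle.
    replace (2 ^ m) with (sum_f_R0 (fun _ => 1) (2 ^ m - 1)).
    - rewrite <- minus_sum. apply sum_Rle. intros k Hk.
      apply inv_sqr_sin_bounds, odd_angle_bound, Hk.
    - rewrite sum_cte. replace (S (2 ^ m - 1)) with (2 ^ m)%nat by lia.
      rewrite pow_INR. replace (INR 2) with 2 by reflexivity. ring. }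
  split.
  - apply Rle_trans with (c * (2 * 4 ^ m - 2 ^ m)); [| apply Rmult_le_compat_l; lra].
    right. unfold c. rewrite pow_inv, H42. field. lra.
  - apply Rle_trans with (c * (2 * 4 ^ m)); [apply Rmult_le_compat_l; lra |].
    right. unfold c. field. lra.
Qed.

Lemma sum_inv_sqr_split (n : nat) :
  sum_f_R0 (fun k => / INR (S k) ^ 2) (2 * n + 1)
  = sum_f_R0 (fun k => / INR (2 * k + 1) ^ 2) n + / 4 * sum_f_R0 (fun k => / INR (S k) ^ 2) n.
Proof.
  induction n as [|n IH]; [simpl; field |].
  replace (2 * S n + 1)%nat with (S (S (2 * n + 1))) by lia.
  rewrite !tech5, IH, Rmult_plus_distr_l.
  replace (S (S (2 * n + 1))) with (2 * S n + 1)%nat by lia.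
  replace (S (2 * S n + 1)) with (2 * S (S n))%nat by lia.
  rewrite (mult_INR 2 (S (S n))). replace (INR 2) with 2 by reflexivity.
  assert (0 < INR (S (S n))) by (apply lt_0_INR; lia).
  assert (0 < INR (2 * S n + 1)) by (apply lt_0_INR; lia).
  field. lra.
Qed.

(** Separating odd and even denominators, the limit [l] satisfies [l = PI^2/8 + l/4]. The odd sum is
    estimated along the indices [2^m - 1], so limits are compared along subsequences. *)
Lemma basel : is_series (fun n => / INR (S n) ^ 2) (PI ^ 2 / 6).
Proof.
  set (u := fun n => / INR (S n) ^ 2). set (v := fun k => / INR (2 * k + 1) ^ 2).
  assert (Hu : forall n, 0 < u n).
  { intros n. apply Rinv_0_lt_compat, pow_lt, lt_0_INR. lia. }
  assert (Hv : forall n, 0 < v n).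
  { intros n. apply Rinv_0_lt_compat, pow_lt, lt_0_INR. lia. }
  assert (Hmono : forall w, (forall n, 0 < w n) -> forall n p,
            sum_f_R0 w n <= sum_f_R0 w (n + p)).
  { intros w Hw n p. induction p as [|p IH]; [rewrite Nat.add_0_r; lra |].
    rewrite Nat.add_succ_r. simpl. specialize (Hw (S (n + p))). lra. }
  assert (Bv : forall n, sum_f_R0 v n <= PI ^ 2 / 8).
  { intros n. assert (n <= 2 ^ n - 1)%nat by (assert (T := Nat.pow_gt_lin_r 2 n); lia).
    eapply Rle_trans; [apply (Hmono v Hv n (2 ^ n - 1 - n)%nat) |].
    replace (n + (2 ^ n - 1 - n))%nat with (2 ^ n - 1)%nat by lia.
    apply sum_inv_odd_sqr_bounds. }
  (* Writing [U], [V] for the partial sums, [U_n <= U_(2n+1) = V_n + U_n/4], whence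
     [3/4 U_n <= PI^2/8]. *)
  assert (Bu : forall n, sum_f_R0 u n <= PI ^ 2 / 6).
  { intros n. assert (T := sum_inv_sqr_split n). fold u v in T.
    assert (M := Hmono u Hu n (n + 1)%nat).
    replace (n + (n + 1))%nat with (2 * n + 1)%nat in M by lia. specialize (Bv n). lra. }
  destruct (ex_finite_lim_seq_incr (sum_f_R0 u) (PI ^ 2 / 6)) as [l Hl].
  { intros n. simpl. specialize (Hu (S n)). lra. }
  { exact Bu. }
  assert (Hphi : forall n, (2 ^ n - 1 < 2 ^ S n - 1)%nat).
  { intros n. assert (2 ^ n <> 0)%nat by (apply Nat.pow_nonzero; lia). simpl. lia. }
  assert (L1 : is_lim_seq (fun m => sum_f_R0 v (2 ^ m - 1)) (PI ^ 2 / 8)).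
  { apply is_lim_seq_le_le with (u := fun m => PI ^ 2 / 8 - PI ^ 2 / 16 * (/ 2) ^ m)
                                (w := fun _ => PI ^ 2 / 8).
    - intros m. apply sum_inv_odd_sqr_bounds.
    - replace (Finite (PI ^ 2 / 8)) with (Finite (PI ^ 2 / 8 - PI ^ 2 / 16 * 0)) by (f_equal; ring).
      apply is_lim_seq_minus'; [apply is_lim_seq_const |].
      apply (is_lim_seq_scal_l (fun m => (/ 2) ^ m) (PI ^ 2 / 16) 0).
      apply is_lim_seq_geom. rewrite Rabs_pos_eq; lra.
    - apply is_lim_seq_const. }
  assert (L2 : is_lim_seq (fun m => sum_f_R0 u (2 ^ m - 1)) l).
  { apply (is_lim_seq_subseq (sum_f_R0 u) l (fun m => (2 ^ m - 1)%nat)); auto.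
    now apply eventually_subseq. }
  assert (L3 : is_lim_seq (fun m => sum_f_R0 u (2 * (2 ^ m - 1) + 1)) l).
  { apply (is_lim_seq_subseq (sum_f_R0 u) l (fun m => (2 * (2 ^ m - 1) + 1)%nat)); auto.
    apply eventually_subseq. intros n. specialize (Hphi n). lia. }
  assert (L4 : is_lim_seq (fun m => sum_f_R0 u (2 * (2 ^ m - 1) + 1)) (PI ^ 2 / 8 + / 4 * l)).
  { apply is_lim_seq_ext with
      (fun m => sum_f_R0 v (2 ^ m - 1) + / 4 * sum_f_R0 u (2 ^ m - 1)).
    { intros m. symmetry. apply sum_inv_sqr_split. }
    apply is_lim_seq_plus'; auto. apply (is_lim_seq_scal_l _ (/ 4) l L2). }
  apply is_lim_seq_unique in L3, L4. rewrite L3 in L4. injection L4 as E.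
  replace (PI ^ 2 / 6) with l by lra.
  unfold is_series. apply is_lim_seq_ext with (2 := Hl). intros n. now rewrite sum_n_Reals.
Qed.

Lemma is_series_Li2 (x : R) : Rabs x <= 1 ->
  is_series (fun n => x ^ S n / INR (S n) ^ 2) (Li2 x).
Proof.
  intros Hx. apply Series_correct.
  apply ex_series_Rabs_le with (fun n => / INR (S n) ^ 2); [| eexists; apply basel].
  intros n. assert (0 < / INR (S n) ^ 2) by (apply Rinv_0_lt_compat, pow_lt, lt_0_INR; lia).
  unfold Rdiv. rewrite Rabs_mult, (Rabs_pos_eq (/ _)) by lra.
  rewrite <- (Rmult_1_l (/ INR (S n) ^ 2)) at 2. apply Rmult_le_compat_r; [lra |].
  rewrite <- RPow_abs, <- (pow1 (S n)). apply pow_incr. split; [apply Rabs_pos | auto].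
Qed.

Definition qt_coef (alpha : R) (k : nat) : R :=
  3 / (3 + alpha) * (1 + alpha / 3 * (- alpha / 3) ^ k).

Lemma is_series_qt_coef_sqr (alpha : R) : -3 < alpha <= 1 ->
  is_series (fun n => / INR (S n) ^ 2 * qt_coef alpha (S n) ^ 2) (4 * sk_bound alpha).
Proof.
  intros Ha.
  assert (S1 := is_series_Li2 (- alpha / 3) ltac:(apply Rabs_le; lra)).
  assert (S2 := is_series_Li2 (alpha ^ 2 / 9) ltac:(apply Rabs_le; simpl; nra)).
  (* With [q = - alpha / 3], squaring [1 + (alpha/3) q^n] produces the terms 1, [2 (alpha/3) q^n]
     and [(alpha^2/9) (q^2)^n]: the Basel series and the two dilogarithms. *)
  set (c := 9 / (3 + alpha) ^ 2).
  apply (@is_series_scal R_AbsRing R_NormedModule (2 * (alpha / 3) * c)) in S1.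
  apply (@is_series_scal R_AbsRing R_NormedModule (alpha ^ 2 / 9 * c)) in S2.
  assert (S0 := @is_series_scal R_AbsRing R_NormedModule c _ _ basel).
  assert (T := @is_series_plus R_AbsRing R_NormedModule _ _ _ _
                 (@is_series_plus R_AbsRing R_NormedModule _ _ _ _ S0 S1) S2).
  match type of T with is_series _ ?l => replace l with (4 * sk_bound alpha) in T end.
  - revert T. apply is_series_ext. intros n.
    change (c * / INR (S n) ^ 2 + 2 * (alpha / 3) * c * ((- alpha / 3) ^ S n / INR (S n) ^ 2)
            + alpha ^ 2 / 9 * c * ((alpha ^ 2 / 9) ^ S n / INR (S n) ^ 2)
            = / INR (S n) ^ 2 * qt_coef alpha (S n) ^ 2).
    replace (alpha ^ 2 / 9) with ((- alpha / 3) ^ 2) at 2 by field.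
    rewrite <- pow_mult, (Nat.mul_comm 2), pow_mult. unfold c, qt_coef.
    assert (0 < INR (S n)) by (apply lt_0_INR; lia).
    field. lra.
  - unfold plus, scal; simpl. unfold mult; simpl. unfold c, sk_bound. simpl. field. lra.
Qed.

Lemma abel_sum_le (c d x : nat -> R) :
  (forall n, sum_f_R0 c n <= sum_f_R0 d n) ->
  (forall n, 0 <= x (S n) <= x n) ->
  forall n, sum_f_R0 (fun k => x k * c k) n <= sum_f_R0 (fun k => x k * d k) n.
Proof.
  intros H Hx.
  assert (Hx0 : forall n, 0 <= x n).
  { intros n. destruct (Hx n). lra. }
  (* The induction carries the boundary term of Abel summation; replacing [x n] by the smaller
     [x (S n)] only lowers the left side, because the unweighted gap is nonnegative. *)
  assert (K : forall n, x n * (sum_f_R0 d n - sum_f_R0 c n)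
    <= sum_f_R0 (fun k => x k * d k) n - sum_f_R0 (fun k => x k * c k) n).
  { induction n as [|n IH]; [simpl; lra |]. rewrite !tech5.
    specialize (H n). destruct (Hx n).
    assert (x (S n) * (sum_f_R0 d n - sum_f_R0 c n) <= x n * (sum_f_R0 d n - sum_f_R0 c n))
      by (apply Rmult_le_compat_r; lra).
    lra. }
  intros n. specialize (K n). specialize (H n).
  assert (0 <= x n * (sum_f_R0 d n - sum_f_R0 c n)) by (apply Rmult_le_pos; auto; lra). lra.
Qed.

(** * Logarithmic coefficients *)

Lemma qt_factor (alpha : R) (z : C) :
  (RtoC 3 + RtoC (alpha - 3) * z + - (RtoC alpha * (z * z)))%C
  = (3 * (1 - z) * (1 - RtoC (- alpha / 3) * z))%C.
Proof.
  rewrite RtoC_minus, RtoC_div, RtoC_opp by lra. field.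
Qed.

Lemma qt_factor_neq_0 (alpha : R) (z : C) : -3 < alpha <= 1 -> Cmod z < 1 ->
  (1 - z)%C <> 0%C /\ (1 - RtoC (- alpha / 3) * z)%C <> 0%C.
Proof.
  intros Ha Hz. split; apply one_minus_neq_0; auto.
  rewrite Cmod_mult, Cmod_R. assert (H := Cmod_ge_0 z).
  assert (Rabs (- alpha / 3) <= 1) by (apply Rabs_le; lra). nra.
Qed.

(** Partial fractions: [3 / ((1 - z)(3 + alpha z))] is [3/(3 + alpha)] times
    [1/(1 - z) + (alpha/3) / (1 + alpha z/3)], a sum of two geometric series. *)
Lemma cpseries_qt (alpha : R) (z : C) : -3 < alpha <= 1 -> Cmod z < 1 ->
  cpseries (fun k => RtoC (qt_coef alpha k)) z (qt alpha z).
Proof.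
  intros Ha Hz. destruct (qt_factor_neq_0 alpha z Ha Hz) as [N1 N2].
  assert (H3 : RtoC 3 <> 0%C) by (intros E; apply RtoC_inj in E; lra).
  assert (H3a : (3 + RtoC alpha)%C <> 0%C).
  { rewrite <- RtoC_plus. intros E; apply RtoC_inj in E; lra. }
  assert (G1 := cseries_geom z Hz).
  assert (Hq : Cmod (RtoC (- alpha / 3) * z)%C < 1).
  { rewrite Cmod_mult, Cmod_R. assert (H := Cmod_ge_0 z).
    assert (Rabs (- alpha / 3) <= 1) by (apply Rabs_le; lra). nra. }
  assert (G2 := cseries_geom _ Hq).
  assert (G := cseries_plus _ _ _ _ (cseries_scal (RtoC (3 / (3 + alpha))) _ _ G1)
    (cseries_scal (RtoC (3 / (3 + alpha)) * RtoC (alpha / 3))%C _ _ G2)).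
  match type of G with cseries _ ?l => replace l with (qt alpha z) in G end.
  - revert G. apply cseries_ext. intros n. unfold qt_coef.
    rewrite RtoC_mult, RtoC_plus, RtoC_mult, RtoC_pow, Cpow_mult_l. ring.
  - unfold qt. rewrite qt_factor. rewrite !RtoC_div by lra. rewrite RtoC_plus, RtoC_opp in *.
    rewrite RtoC_div, RtoC_opp in N2 by lra.
    assert (N3 : (3 + RtoC alpha * z)%C <> 0%C).
    { intros E. apply N2. replace (1 - - alpha / 3 * z)%C with ((3 + RtoC alpha * z) / 3)%C
        by (now field). rewrite E. now field. }
    assert (N4 : (3 - - RtoC alpha * z)%C <> 0%C).
    { replace (3 - - RtoC alpha * z)%C with (3 + RtoC alpha * z)%C by ring. exact N3. }
    field. repeat split; auto.
Qed.

Lemma absconv_qt_coef (alpha : R) : -3 < alpha <= 1 ->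
  absconv (fun k => RtoC (qt_coef alpha k)).
Proof.
  intros Ha. apply absconv_of_cpseries. intros z Hz. eexists. now apply cpseries_qt.
Qed.

(* The coefficients of [1 + z L'(z)], where [L = sum c_n z^n]. *)
Definition euler_coef (c : nat -> C) (k : nat) : C :=
  match k with O => 1%C | S m => dcoef c m end.

Lemma cpseries_euler_coef (c : nat -> C) (z : C) : absconv c -> Cmod z < 1 ->
  cpseries (euler_coef c) z (1 + z * psum (dcoef c) z)%C.
Proof.
  intros Hc Hz.
  assert (H := cpseries_psum_of_absconv _ z (absconv_dcoef c Hc) Hz).
  apply (cseries_scal z) in H.
  replace (1 + z * psum (dcoef c) z)%C
    with (z ^ 0 * euler_coef c 0 + z * psum (dcoef c) z)%C by (simpl; ring).
  apply (cseries_S (fun n => z ^ n * euler_coef c n)%C).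
  eapply cseries_ext; [| exact H]. intros n. simpl. ring.
Qed.

Lemma absconv_euler_coef (c : nat -> C) : absconv c -> absconv (euler_coef c).
Proof.
  intros Hc. apply absconv_of_cpseries. intros z Hz. eexists. now apply cpseries_euler_coef.
Qed.

Lemma cderiv_id_mult_Cexp (c : nat -> C) (z : C) : absconv c -> Cmod z < 1 ->
  cderiv (fun x => x * Cexp (psum c x))%C z
    (Cexp (psum c z) * psum (euler_coef c) z)%C.
Proof.
  intros Hc Hz. rewrite (cpseries_psum _ _ _ (cpseries_euler_coef c z Hc Hz)).
  eapply cderiv_eq.
  - apply (cderiv_mult (fun x => x) (fun x => Cexp (psum c x))); [apply cderiv_id |].
    apply (cderiv_comp Cexp (psum c)); [apply cderiv_Cexp | now apply cderiv_psum].
  - simpl. ring.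
Qed.

(** Repeats the coefficient function inside [log_coeffs], so that the two are convertible. *)
Definition log_coef_seq (gamma : nat -> C) (n : nat) : C :=
  if Nat.eqb n 0 then 0%C else (RtoC 2 * gamma n)%C.

Lemma log_coeffs_psum (f : C -> C) (gamma : nat -> C) :
  log_coeffs f gamma -> f 0%C = 0%C ->
  absconv (log_coef_seq gamma) /\
  forall z, in_disc z -> f z = (z * Cexp (psum (log_coef_seq gamma) z))%C.
Proof.
  intros H H0. split.
  - apply absconv_of_cpseries. intros z Hz. destruct (H z Hz) as [L [HL _]].
    exists L. apply is_pseries_iff in HL. exact HL.
  - intros z Hz. destruct (Ceq_dec z 0%C) as [-> | Hz0]; [rewrite H0; ring |].
    destruct (H z Hz) as [L [HL HE]]. apply is_pseries_iff in HL.
    apply (cpseries_psum (log_coef_seq gamma)) in HL. rewrite HL, HE by auto. now field.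
Qed.

Lemma in_disc_radius (z : C) : in_disc z ->
  exists d : posreal, forall y, Cmod (y - z)%C < d -> in_disc y.
Proof.
  intros Hz. unfold in_disc in *. assert (H : 0 < 1 - Cmod z) by lra.
  exists (mkposreal _ H). simpl. intros y Hy.
  assert (T := Cmod_triangle_inv y z). lra.
Qed.

(** Differentiating [f = z e^L] gives [z f'/f = 1 + z L'] away from 0; at 0 the value [f' 0 = 1] set
    by [zfp_over_f] is the constant coefficient. *)
Lemma SK_euler_coef (alpha : R) (f : C -> C) (gamma : nat -> C) :
  SK alpha f -> log_coeffs f gamma ->
  absconv (log_coef_seq gamma) /\
  exists w, analytic_on_disc w /\ w 0%C = 0%C /\
    (forall z, in_disc z -> in_disc (w z)) /\
    (forall z, in_disc z -> psum (euler_coef (log_coef_seq gamma)) z = qt alpha (w z)).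
Proof.
  intros [f' [Hf [Hf0 [Hf0' [_ [w [Hw [Hw0 [Hwd Hwq]]]]]]]]] Hg.
  destruct (log_coeffs_psum f gamma Hg Hf0) as [Hc Hfz]. split; auto.
  exists w. repeat split; auto. intros z Hz. rewrite <- Hwq by auto.
  assert (D : f' z = (Cexp (psum (log_coef_seq gamma) z)
                        * psum (euler_coef (log_coef_seq gamma)) z)%C).
  { apply cderiv_unique with f z; [apply C_is_derive_iff; auto |].
    destruct (in_disc_radius z Hz) as [d Hd].
    apply cderiv_ext_loc with (fun x => x * Cexp (psum (log_coef_seq gamma) x))%C d.
    - intros y Hy. symmetry. apply Hfz. now apply Hd.
    - now apply cderiv_id_mult_Cexp. }
  unfold zfp_over_f. destruct (Ceq_dec z 0%C) as [-> | Hz0].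
  - rewrite Hf0'. apply psum_0. now apply absconv_euler_coef.
  - rewrite D, (Hfz z Hz). field. split; auto. apply Cexp_neq_0.
Qed.

(** This is the derivative of the denominator of [qt]. A zero would force
    [3 - alpha = 2 |alpha| |w|], whereas [2 |alpha| <= 3 - alpha] on the given range and
    [|w| < 1]. *)
Lemma qt_deriv_neq_0 (alpha : R) (w : C) : -3 < alpha <= 1 -> Cmod w < 1 ->
  (RtoC (alpha - 3) - 2 * RtoC alpha * w)%C <> 0%C.
Proof.
  intros Ha Hw E.
  assert (E2 : RtoC (alpha - 3) = (2 * RtoC alpha * w)%C) by (apply Ceq_minus; exact E).
  apply (f_equal Cmod) in E2. rewrite !Cmod_mult, !Cmod_R in E2.
  rewrite (Rabs_left (alpha - 3)), (Rabs_pos_eq 2) in E2 by lra.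
  assert (H := Cmod_ge_0 w). assert (H' := Rabs_pos alpha).
  assert (Hb : 2 * Rabs alpha <= 3 - alpha)
    by (unfold Rabs; destruct (Rcase_abs alpha); lra).
  assert (Rabs alpha * Cmod w <= Rabs alpha) by nra.
  assert (Hz : Rabs alpha * (1 - Cmod w) = 0) by nra.
  apply Rmult_integral in Hz. destruct Hz as [Hz | Hz]; [| lra].
  rewrite Hz in E2. assert (alpha = 0) by (apply Rabs_eq_0; auto). lra.
Qed.

(* [qt alpha] has no critical point in the disc, so [w'] can be solved from the derivative
   of [A z * den (w z) = 3] and is continuous. *)
Lemma hol_of_qt_comp (alpha : R) (a : nat -> C) (w : C -> C) : -3 < alpha <= 1 ->
  absconv a -> analytic_on_disc w -> (forall z, in_disc z -> in_disc (w z)) ->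
  (forall z, in_disc z -> psum a z = qt alpha (w z)) ->
  hol in_disc w.
Proof.
  intros Ha Habs Hw Hd Hq.
  set (den := fun x => (RtoC 3 + RtoC (alpha - 3) * x + - (RtoC alpha * (x * x)))%C).
  set (den' := fun x => (RtoC (alpha - 3) + - (2 * RtoC alpha) * x)%C).
  assert (H3 : RtoC 3 <> 0%C) by (intros E; apply RtoC_inj in E; lra).
  assert (Hden : forall x, Cmod x < 1 -> den x <> 0%C).
  { intros x Hx. unfold den. rewrite qt_factor. destruct (qt_factor_neq_0 alpha x Ha Hx).
    repeat apply Cmult_neq_0; auto. }
  assert (Hprod : forall z, in_disc z -> (psum a z * den (w z))%C = 3).
  { intros z Hz. rewrite Hq by auto. unfold qt. fold (den (w z)). field.
    apply Hden, Hd, Hz. }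
  assert (Ha0 : forall z, in_disc z -> psum a z <> 0%C).
  { intros z Hz E. assert (P := Hprod z Hz). rewrite E, Cmult_0_l in P. auto. }
  assert (Hden' : forall x, Cmod x < 1 -> den' x <> 0%C).
  { intros x Hx. unfold den'.
    replace (RtoC (alpha - 3) + - (2 * RtoC alpha) * x)%C
      with (RtoC (alpha - 3) - 2 * RtoC alpha * x)%C by ring.
    now apply qt_deriv_neq_0. }
  assert (Dden : forall x, cderiv den x (den' x)).
  { intros x. eapply cderiv_ext_loc with (d := mkposreal 1 Rlt_0_1)
      (f := fun x => (RtoC 3 + RtoC (alpha - 3) * x + (- RtoC alpha) * (x * x))%C).
    - intros y _. unfold den. ring.
    - eapply cderiv_eq.
      + apply cderiv_plus; [apply cderiv_plus; [apply cderiv_const |] |].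
        * apply (cderiv_mult (fun _ => RtoC (alpha - 3)) (fun x => x));
            [apply cderiv_const | apply cderiv_id].
        * apply (cderiv_mult (fun _ => (- RtoC alpha)%C) (fun x => x * x)%C);
            [apply cderiv_const |].
          apply (cderiv_mult (fun x => x) (fun x => x)); apply cderiv_id.
      + unfold den'. ring. }
  exists (fun z => (- (1) * (psum (dcoef a) z * (den (w z)
                      * / (psum a z * den' (w z)))))%C).
  intros z Hz.
  destruct (Hw z Hz) as [l Hl]. apply C_is_derive_iff in Hl.
  assert (Hcw := cderiv_cont _ _ _ Hl).
  assert (Da := cderiv_psum a z Habs Hz).
  assert (N1 := Ha0 z Hz). assert (N2 := Hden' _ (Hd z Hz)).
  split.
  - apply (cderiv_eq _ _ _ _ Hl).
    assert (E : (psum (dcoef a) z * den (w z) + psum a z * (l * den' (w z)))%C = 0).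
    { apply cderiv_unique with (fun x => psum a x * den (w x))%C z.
      - apply (cderiv_mult (psum a) (fun x => den (w x))); auto.
        now apply (cderiv_comp den w).
      - destruct (in_disc_radius z Hz) as [d Hdz].
        apply cderiv_ext_loc with (fun _ => RtoC 3) d; [| apply cderiv_const].
        intros y Hy. symmetry. apply Hprod. now apply Hdz. }
    replace l with ((psum (dcoef a) z * den (w z) + psum a z * (l * den' (w z)))
       * / (psum a z * den' (w z))
       + - (1) * (psum (dcoef a) z * (den (w z) * / (psum a z * den' (w z)))))%C
      by (field; auto).
    rewrite E. ring.
  - apply ccont_mult; [apply ccont_const |]. apply ccont_mult.
    { apply cderiv_cont with (1 := cderiv_psum _ z (absconv_dcoef a Habs) Hz). }
    apply ccont_mult.
    { apply (ccont_comp den w); auto. apply cderiv_cont with (1 := Dden (w z)). }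
    apply (ccont_comp Cinv (fun z => psum a z * den' (w z))%C).
    + apply ccont_mult; [now apply cderiv_cont with (1 := Da) |].
      apply (ccont_comp den' w); auto. apply ccont_plus; [apply ccont_const |].
      apply ccont_mult; [apply ccont_const | apply ccont_id].
    + eapply cderiv_cont, cderiv_Cinv. now apply Cmult_neq_0.
Qed.

Lemma SK_log_coeffs_bound (alpha : R) (f : C -> C) (gamma : nat -> C) (n : nat) :
  -3 < alpha <= 1 -> SK alpha f -> log_coeffs f gamma ->
  sum_f_R0 (sq_terms gamma) n
    <= / 4 * sum_f_R0 (fun k => / INR (S k) ^ 2 * qt_coef alpha (S k) ^ 2) n.
Proof.
  intros Ha Hf Hg.
  destruct (SK_euler_coef alpha f gamma Hf Hg) as [Hc [w [Hw [Hw0 [Hwd Hwq]]]]].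
  set (a := euler_coef (log_coef_seq gamma)) in *.
  assert (Haa : absconv a) by now apply absconv_euler_coef.
  assert (Hab : forall z, in_disc z ->
            psum a z = psum (fun k => RtoC (qt_coef alpha k)) (w z)).
  { intros z Hz. rewrite Hwq by auto. symmetry. apply cpseries_psum, cpseries_qt; auto.
    now apply Hwd. }
  assert (Hhol := hol_of_qt_comp alpha a w Ha Haa Hw Hwd Hwq).
  (* Both constant coefficients are 1, so they cancel from Rogosinski's inequality and the sums
     start at index 1, where the weights [1/k^2] make sense. *)
  assert (R0 : forall m, sum_f_R0 (fun k => Cmod (a (S k)) ^ 2) m
                         <= sum_f_R0 (fun k => qt_coef alpha (S k) ^ 2) m).
  { intros m.
    assert (T := rogosinski a _ w (S m) Haa (absconv_qt_coef alpha Ha) Hhol Hw0 Hwd Hab).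
    rewrite !sum_f_R0_S in T. cbv beta in T.
    replace (qt_coef alpha 0) with 1 in T by (unfold qt_coef; simpl; field; lra).
    replace (a O) with (RtoC 1) in T by reflexivity.
    apply Rplus_le_reg_l in T. eapply Rle_trans; [exact T |]. right.
    apply sum_eq. intros i _. rewrite Cmod_R. apply pow2_abs. }
  apply Rmult_le_reg_l with 4; [lra |]. rewrite <- Rmult_assoc, Rinv_r, Rmult_1_l by lra.
  assert (A := abel_sum_le _ _ (fun k => / INR (S k) ^ 2) R0).
  eapply Rle_trans; [| apply A].
  - rewrite scal_sum. right. apply sum_eq. intros k _.
    unfold sq_terms, a, euler_coef, dcoef, log_coef_seq. simpl Nat.eqb. cbv iota.
    rewrite !Cmod_mult, !Cmod_R, (Rabs_pos_eq 2), (Rabs_pos_eq (INR _)) by (try apply pos_INR; lra).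
    assert (0 < INR (S k)) by (apply lt_0_INR; lia). field. lra.
  - intros k. assert (0 < INR (S k)) by (apply lt_0_INR; lia).
    rewrite (S_INR (S k)). split.
    + apply Rlt_le, Rinv_0_lt_compat, pow_lt. lra.
    + apply Rinv_le_contravar; [apply pow_lt; lra |]. apply pow_incr. lra.
Qed.

(** * The extremal function and the conclusion *)

Definition extremal_log_coef (alpha : R) (n : nat) : C :=
  RtoC (qt_coef alpha n / (2 * INR n)).

Lemma absconv_extremal (alpha : R) : -3 < alpha <= 1 ->
  absconv (log_coef_seq (extremal_log_coef alpha)).
Proof.
  intros Ha. apply absconv_of_bound. intros s Hs.
  destruct (absconv_bound _ s (absconv_qt_coef alpha Ha) ltac:(lra)) as [M HM].
  exists M. intros n. eapply Rle_trans; [| apply HM].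
  apply Rmult_le_compat_r; [apply pow_le; lra |].
  (* At [n = 0], [log_coef_seq] overrides the division by zero in [extremal_log_coef]. *)
  destruct n as [|n]; [unfold log_coef_seq; simpl Nat.eqb; cbv iota; rewrite Cmod_0; apply Cmod_ge_0 |].
  unfold log_coef_seq, extremal_log_coef. simpl Nat.eqb. cbv iota.
  assert (Hn : 1 <= INR (S n)) by (rewrite S_INR; assert (T := pos_INR n); lra).
  rewrite <- RtoC_mult, !Cmod_R.
  replace (2 * (qt_coef alpha (S n) / (2 * INR (S n)))) with (qt_coef alpha (S n) * / INR (S n))
    by (field; lra).
  rewrite Rabs_mult. rewrite <- (Rmult_1_r (Rabs (qt_coef alpha (S n)))) at 2.
  apply Rmult_le_compat_l; [apply Rabs_pos |].
  rewrite Rabs_pos_eq by (apply Rlt_le, Rinv_0_lt_compat; lra).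
  rewrite <- Rinv_1. apply Rinv_le_contravar; lra.
Qed.

Lemma psum_euler_extremal (alpha : R) (z : C) : -3 < alpha <= 1 -> in_disc z ->
  psum (euler_coef (log_coef_seq (extremal_log_coef alpha))) z = qt alpha z.
Proof.
  intros Ha Hz. apply cpseries_psum. apply cseries_ext with (2 := cpseries_qt alpha z Ha Hz).
  intros [|n]; f_equal.
  - simpl. f_equal. unfold qt_coef. simpl. field. lra.
  - unfold euler_coef, dcoef, log_coef_seq, extremal_log_coef. simpl Nat.eqb. cbv iota.
    rewrite <- !RtoC_mult. f_equal.
    assert (0 < INR (S n)) by (apply lt_0_INR; lia). field. lra.
Qed.

Theorem theorem3p3 (alpha : R) (Halpha : -3 < alpha <= 1) :
  (forall f : C -> C, SK alpha f ->
     forall gamma : nat -> C, log_coeffs f gamma ->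
       ex_series (sq_terms gamma) /\ Series (sq_terms gamma) <= sk_bound alpha) /\
  (exists f : C -> C, SK alpha f /\
     exists gamma : nat -> C, log_coeffs f gamma /\
       ex_series (sq_terms gamma) /\ Series (sq_terms gamma) = sk_bound alpha).
Proof.
  assert (HS : is_series (fun n => / 4 * (/ INR (S n) ^ 2 * qt_coef alpha (S n) ^ 2))
                 (sk_bound alpha)).
  { replace (sk_bound alpha) with (/ 4 * (4 * sk_bound alpha)) by field.
    apply (@is_series_scal R_AbsRing R_NormedModule (/ 4)).
    now apply is_series_qt_coef_sqr. }
  split.
  - intros f Hf gamma Hg.
    assert (HS' : is_lim_seq (sum_n (fun n => / 4 * (/ INR (S n) ^ 2 * qt_coef alpha (S n) ^ 2)))
                    (sk_bound alpha)) by exact HS.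
    assert (Hle : forall n, sum_n (sq_terms gamma) n <=
              sum_n (fun n => / 4 * (/ INR (S n) ^ 2 * qt_coef alpha (S n) ^ 2)) n).
    { intros n. rewrite !sum_n_Reals.
      eapply Rle_trans; [apply (SK_log_coeffs_bound alpha f gamma n Halpha Hf Hg) |].
      right. rewrite scal_sum. apply sum_eq. intros. ring. }
    assert (Hincr : forall n, sum_n (sq_terms gamma) n <= sum_n (sq_terms gamma) (S n)).
    { intros n. rewrite sum_Sn. unfold plus; simpl. unfold sq_terms.
      assert (T := pow2_ge_0 (Cmod (gamma (S (S n))))). simpl in *. lra. }
    (* The partial sums increase and stay below those of the [B_k] series, which increase to
       [sk_bound alpha]; this gives convergence before the sum is estimated. *)
    destruct (ex_finite_lim_seq_incr (sum_n (sq_terms gamma)) (sk_bound alpha)) as [l Hl]; auto.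
    { intros n. eapply Rle_trans; [apply Hle |].
      apply is_lim_seq_incr_compare; [exact HS' |].
      intros m. rewrite sum_Sn.
      assert (0 < / INR (S (S m)) ^ 2) by (apply Rinv_0_lt_compat, pow_lt, lt_0_INR; lia).
      assert (T := pow2_ge_0 (qt_coef alpha (S (S m)))).
      assert (0 <= / INR (S (S m)) ^ 2 * qt_coef alpha (S (S m)) ^ 2)
        by (apply Rmult_le_pos; lra).
      match goal with |- ?x <= plus ?x ?y => change (x <= x + y) end. lra. }
    assert (Hs : is_series (sq_terms gamma) l) by exact Hl.
    split; [now exists l |]. rewrite (is_series_unique _ _ Hs).
    apply (is_lim_seq_le _ _ l (sk_bound alpha) Hle Hl HS').
  (* Building [f = z e^L] from its logarithm makes it zero-free off 0 and settles the branch;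
     [f' 0 = 1] follows from [L 0 = 0]. *)
  - set (gamma := extremal_log_coef alpha). set (c := log_coef_seq gamma).
    assert (Hc : absconv c) by now apply absconv_extremal.
    assert (H1 : in_disc 0%C) by (unfold in_disc; rewrite Cmod_0; lra).
    assert (Hc0 : psum c 0%C = 0%C) by now apply psum_0.
    assert (Hq0 : psum (euler_coef c) 0%C = 1%C) by now apply psum_0, absconv_euler_coef.
    exists (fun z => (z * Cexp (psum c z))%C). split.
    + exists (fun z => (Cexp (psum c z) * psum (euler_coef c) z)%C).
      split; [| split; [| split; [| split]]].
      * intros z Hz. apply C_is_derive_iff. now apply cderiv_id_mult_Cexp.
      * ring.
      * rewrite Hc0, Hq0, Cexp_0. ring.
      * intros z _ Hz. apply Cmult_neq_0; auto. apply Cexp_neq_0.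
      * exists (fun z => z). split; [| split; [| split]]; auto.
        -- intros z _. exists (RtoC 1). apply C_is_derive_iff, cderiv_id.
        -- intros z Hz. rewrite <- psum_euler_extremal by auto. fold gamma c.
           unfold zfp_over_f. destruct (Ceq_dec z 0%C) as [-> | Hz0].
           ++ rewrite Hc0, Hq0, Cexp_0. ring.
           ++ field. split; auto. apply Cexp_neq_0.
    + exists gamma. split.
      * intros z Hz. exists (psum c z). split.
        -- apply is_pseries_iff. now apply (cpseries_psum_of_absconv c).
        -- intros Hz0. now field.
      * assert (Hs : is_series (sq_terms gamma) (sk_bound alpha)).
        { revert HS. apply is_series_ext. intros n. unfold sq_terms, gamma, extremal_log_coef.
          rewrite Cmod_R, pow2_abs. unfold scal; simpl scal. unfold mult; simpl mult.
          assert (0 < INR (S n)) by (apply lt_0_INR; lia).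
          change (/ 4 * (/ INR (S n) ^ 2 * qt_coef alpha (S n) ^ 2)
                  = (qt_coef alpha (S n) / (2 * INR (S n))) ^ 2).
          field. lra. }
        split; [now exists (sk_bound alpha) |]. now apply is_series_unique.
Qed.
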